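(* Let $q>1$ be real and let $(a_n)_{n\ge1}$ be a sequence of positive integers with $a_{n+1}\ge q\,a_n$ for all $n\ge1$. For Lebesgue-almost every $x\in\mathbb{T}$, $$\liminf_{N\to\infty}\frac{N\,G_N(x)}{\log N}\ \ge\ \frac12,$$ and $$\limsup_{N\to\infty}\frac{N\,G_N(x)}{\log N}\ \le\ 1+2\Gamma\ \le\ \frac{q+1}{q-1}.$$
   Context: $\mathbb{T}=\mathbb{R}/\mathbb{Z}$ with Lebesgue (Haar probability) measure. An interval in $\mathbb{T}$ is a circular arc, and $|J|$ denotes its length. For $x\in\mathbb{T}$ and $N\ge1$ put $A_N(x)=\{a_1x,\ldots,a_Nx\}\subset\mathbb{T}$ and define the maximal circular gap $$G_N(x)=\sup\{|J|:\ J\subset\mathbb{T}\text{ is an interval and }J\cap A_N(x)=\varnothing\}.$$ The constant $\Gamma$ is defined by $$\Gamma=\limsup_{L\to\infty}\ \sup_{p\ge1}\ \Gamma(p,L),\qquad \Gamma(p,L)=\frac1L\sum_{m=p}^{p+L-1}\ \sum_{n=m+1}^{p+L}\frac{a_m}{a_n},$$ where $p,L$ range over positive integers. *)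

(* Defs.v *)
From HB Require Import structures.
From mathcomp Require Import all_boot all_order all_algebra.
From mathcomp Require Import all_classical all_reals all_analysis.

Set Implicit Arguments.
Unset Strict Implicit.
Unset Printing Implicit Defensive.

Import Order.TTheory GRing.Theory Num.Theory.

Local Open Scope classical_set_scope.
Local Open Scope ring_scope.

(* The circle R/Z is represented by its fundamental domain [0, 1); its Haar
   probability measure is then the Lebesgue measure on [0, 1). *)
Definition circle {R : realType} : set R := `[0, 1[.

Definition circle_proj {R : realType} (t : R) : R := t - (Num.floor t)%:~R.

(* Circular arcs are the images of the real intervals, of whatever kind, so an
   arc may wrap around 0. *)
Definition is_arc {R : realType} (J : set R) : Prop :=
  exists I : interval R, J = circle_proj @` [set` I].

Definition arc_length {R : realType} (J : set R) : R :=
  fine (lebesgue_measure J).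

(* Sequences are indexed from 1: the value a 0 is never used. *)
Definition dilates {R : realType} (a : nat -> nat) (N : nat) (x : R) : set R :=
  [set circle_proj ((a n)%:R * x) | n in [set n | (1 <= n <= N)%N]].

Definition max_gap {R : realType} (a : nat -> nat) (N : nat) (x : R) : R :=
  sup [set arc_length J | J in
         [set J : set R | is_arc J /\ J `&` dilates a N x = set0]].

Definition Gamma_avg {R : realType} (a : nat -> nat) (p L : nat) : R :=
  L%:R^-1 * \sum_(p <= m < p + L) \sum_(m.+1 <= n < (p + L).+1)
              ((a m)%:R / (a n)%:R).

Definition Gamma {R : realType} (a : nat -> nat) : \bar R :=
  limn_esup (fun L : nat =>
    ereal_sup [set (Gamma_avg a p L)%:E | p in [set p | (1 <= p)%N]]).

Definition normalized_gap {R : realType} (a : nat -> nat) (x : R) (N : nat) : R :=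
  N%:R * max_gap a N x / ln N%:R.

(* Main.v *)
Require Import Defs.
From HB Require Import structures.
From mathcomp Require Import all_boot all_order all_algebra.
From mathcomp Require Import all_classical all_reals all_analysis.
From mathcomp Require Import zify ring lra.

Set Implicit Arguments.
Unset Strict Implicit.
Unset Printing Implicit Defensive.

Import Order.TTheory GRing.Theory Num.Theory.

Local Open Scope classical_set_scope.
Local Open Scope ring_scope.

(** Everything is reduced to counting.  For fixed N, cut the circle into M equal
    cells and let Q be a common multiple of the numbers M * a n, n <= N.  With
    b n = Q / (M * a n), the cell that contains (a n) x is (j %/ b n) %% M, where
    j is the integer part of Q x.  So the Lebesgue measure of an event about
    these cells is the proportion of the j < Q for which it holds.

    The scales b n decrease geometrically, and this replaces independence.  An
    event about the first n0 points is constant on most intervals of j of a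
    length h, a small fraction of b n0, while for n >= n0 + g, with g a large multiple
    of log N, the period M * b n is so small compared with h that the n-th point
    is equidistributed on each of these intervals ([mesh_decouple],
    [mesh_coarse]).

    Upper bound.  Fix an arc of measure del.  In a block of L consecutive
    indices the number S of visits has mean L * del.  Two visits at times m < n
    have joint probability at most del * (del + a m / a n), because the visit at
    time m confines x to intervals of length del / a m, and each of them meets at
    most one more period 1 / a n than the proportional share.  So E S^2 is at
    most L * del * (1 + 2 Gamma + L * del), and S > 0 has probability at least
    about L * del / (1 + 2 Gamma) ([comb_missed_le]).  Taking L = g^2, the gaps
    of length g left between the blocks cost nothing asymptotically, and the
    blocks are almost independent: the arc is missed by all N points with
    probability about exp (- N del / (1 + 2 Gamma)) ([missed_arc_count]).  For
    del = lam * log N / N with lam > 1 + 2 Gamma this is N^(-1-c), which is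
    summable over the O(N) arcs of a fine family and over a geometric sequence of
    values of N ([large_gap_rare]); monotonicity of the gap fills in the other N.

    Lower bound.  Take M cells of length just above c * log N / N, with c < 1/2,
    and let Z n be the number of cells not visited up to time n.  At each step Z
    decreases by at most one, and it does so with conditional probability about
    Z / M, where the conditioning must be done g steps earlier.  Following the
    mean of exp (- th * Z n), with th allowed to shrink by a factor 1 - 2 / M
    per step (a factor 2 is lost here, which c < 1/2 affords), shows that
    Z N = 0 has probability at most N^(-2) up to a constant ([phi_step],
    [all_hit_count], [small_gap_rare]), and this is summable over all N.

    Both parts conclude by the Borel-Cantelli lemma ([ae_eventually]).  The bound
    Gamma <= 1 / (q - 1) is a geometric series. *)

(** * Sums of periodic functions, and decoupling of scales *)

Section PeriodicSums.
Local Open Scope nat_scope.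

Lemma leq_sum_sub (f : nat -> nat) (s s' e e' : nat) :
  s' <= s -> e <= e' ->
  \sum_(s <= j < e) f j <= \sum_(s' <= j < e') f j.
Proof.
move=> ss ee; case: (leqP e s) => [le_es|lt_se]; first by rewrite big_geq.
rewrite (@big_cat_nat _ _ _ s s' e') //=; last by lia.
rewrite (@big_cat_nat _ _ _ e s e') //=; last by lia.
by rewrite addnCA leq_addr.
Qed.

Variables (f : nat -> nat) (P : nat).
Hypothesis fP : forall j, f (j + P) = f j.

Lemma sum_period s : \sum_(s <= j < s + P) f j = \sum_(0 <= j < P) f j.
Proof.
elim: s => [|s <-]; first by rewrite add0n.
case: P fP => [|p] fp; first by rewrite !big_geq // !addn0.
by rewrite addSn big_nat_recr /= ?leq_addr// ?fp; last lia; rewrite addnC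
  [RHS]big_ltn //; lia.
Qed.

Lemma sum_periods s k :
  \sum_(s <= j < s + k * P) f j = k * \sum_(0 <= j < P) f j.
Proof.
elim: k => [|k IH]; first by rewrite big_geq // addn0.
rewrite (@big_cat_nat _ _ _ (s + k * P)) //=; [|by lia..].
by rewrite IH mulSn [P + _]addnC addnA sum_period addnC mulSn.
Qed.

Lemma sum_periodic_le s l : 0 < P ->
  \sum_(s <= j < s + l) f j <= (l %/ P).+1 * \sum_(0 <= j < P) f j.
Proof.
move=> P0; rewrite -(sum_periods s); apply: leq_sum_sub => //.
by rewrite leq_add2l ltnW // ltn_ceil.
Qed.

Lemma sum_periodic_ge s l :
  l %/ P * \sum_(0 <= j < P) f j <= \sum_(s <= j < s + l) f j.
Proof.
rewrite -(sum_periods s); apply: leq_sum_sub => //.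
by rewrite leq_add2l leq_divM.
Qed.

End PeriodicSums.

Section Runs.
Local Open Scope nat_scope.

(** The residues below T form one run of length T in each period, and the
    interval meets at most two periods more than it can contain. *)
Lemma sum_runs_le (g : nat -> nat) (P T G s l : nat) : 0 < P -> T <= P ->
  (forall u, \sum_(u <= j < u + T) g j <= G) ->
  \sum_(s <= j < s + l) (j %% P < T) * g j <= (l %/ P).+2 * G.
Proof.
move=> P0 TP gG; pose F j := (j %% P < T) * g j.
have run u : \sum_(u * P <= j < u * P + P) F j <= G.
  rewrite (@big_cat_nat _ _ _ (u * P + T)) //=; [|by lia..].
  rewrite [X in _ + X]big1_seq => [|j]; last first.
    rewrite mem_index_iota /= => /andP[j1 j2]; rewrite /F.
    have -> : j = u * P + (j - u * P) by lia.
    by rewrite modnMDl modn_small; lia.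
  rewrite addn0; apply: leq_trans (gG (u * P)); apply: leq_sum => j _.
  by rewrite /F; case: (_ < _); rewrite ?mul1n ?mul0n.
have runs u k : \sum_(u * P <= j < u * P + k * P) F j <= k * G.
  elim: k => [|k IH]; first by rewrite addn0 big_geq.
  rewrite (@big_cat_nat _ _ _ (u * P + k * P)) //=; [|by lia..].
  rewrite [k.+1 * G]mulSn addnC leq_add //.
  by rewrite mulSn [P + _]addnC addnA -mulnDl run.
apply: leq_trans (runs (s %/ P) (l %/ P).+2); apply: leq_sum_sub.
  exact: leq_divM.
have := ltn_ceil s P0; have := ltn_ceil l P0; rewrite !mulSn; lia.
Qed.

Lemma modn_run_periodic (P T d j : nat) :
  ((j + P + d) %% P < T) = ((j + d) %% P < T).
Proof. by rewrite addnAC modnDr. Qed.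

Lemma sum_run_period (P T d : nat) : T <= P ->
  \sum_(0 <= j < P) ((j + d) %% P < T) = T.
Proof.
move=> TP; transitivity (\sum_(d <= j < d + P) (j %% P < T)).
  by rewrite -{2}[d]add0n big_addn addKn.
rewrite sum_period; last by move=> j; rewrite modnDr.
rewrite (@big_cat_nat _ _ _ T) //= (@eq_big_nat _ _ _ 0 T _ (fun=> 1)).
  rewrite sum_nat_const_nat subn0 muln1.
  rewrite big_nat_cond big1 ?addn0 // => j /andP[/andP[h1 h2] _].
  by rewrite modn_small // ltnNge h1.
by move=> j /andP[_ jT]; rewrite modn_small ?jT //; lia.
Qed.

(** The joint visits of two progressions of runs.  When the slow runs are shorter
    than the fast period, T1 %/ P2 vanishes and the remaining 1 is what produces
    the correlation term P2 / P1. *)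
Lemma sum_two_runs_le (P1 T1 d1 P2 T2 d2 s l : nat) :
  0 < P1 -> 0 < P2 -> T1 <= P1 -> T2 <= P2 ->
  \sum_(s <= j < s + l)
     ((j + d1) %% P1 < T1) * ((j + d2) %% P2 < T2)
  <= (l %/ P1).+2 * ((T1 %/ P2).+1 * T2).
Proof.
move=> P10 P20 TP1 TP2.
(* The shift d2 - d1 between the two progressions, made nonnegative by adding
   P2 * d1. *)
pose g y : nat := (y + (d2 + P2.-1 * d1)) %% P2 < T2.
have -> : \sum_(s <= j < s + l)
     ((j + d1) %% P1 < T1) * ((j + d2) %% P2 < T2) =
  \sum_(s + d1 <= y < s + d1 + l) (y %% P1 < T1) * g y.
  rewrite addnAC -{2}(addnK d1 (s + l)) big_addn addnK addnK.
  apply: eq_bigr => j _; rewrite /g; congr (_ * _).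
  have -> : j + d1 + (d2 + P2.-1 * d1) = d1 * P2 + (j + d2).
    by rewrite -[in RHS](prednK P20); lia.
  by rewrite modnMDl.
apply: sum_runs_le => // u.
apply: leq_trans (sum_periodic_le _ u T1 P20) _ => [j|].
  by rewrite /g modn_run_periodic.
by rewrite /g sum_run_period.
Qed.

Lemma sum_digit_period (f : nat -> nat) (b M : nat) : 0 < b ->
  \sum_(0 <= j < M * b) f ((j %/ b) %% M) = b * \sum_(0 <= v < M) f v.
Proof.
move=> b0.
have sub k : \sum_(0 <= j < k * b) f (j %/ b) = b * \sum_(0 <= v < k) f v.
  elim: k => [|k IH]; first by rewrite !big_geq ?muln0.
  rewrite (@big_cat_nat _ _ _ (k * b)) //=; last by rewrite leq_mul.
  rewrite big_nat_recr //= IH mulnDr; congr (_ + _).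
  rewrite -[b in RHS](_ : k.+1 * b - k * b = b); last by rewrite -mulnBl subSnn mul1n.
  rewrite -sum_nat_const_nat; apply: eq_big_nat => j jk; congr f.
  by apply/eqP; rewrite eqn_leq leq_divRL // -ltnS ltn_divLR // andbC.
rewrite -sub; apply: eq_big_nat => j /andP[_ jM].
by rewrite modn_small // ltn_divLR.
Qed.

End Runs.

Section Decoupling.
Local Open Scope ring_scope.
Variable R : numDomainType.

Lemma sum_cells (F : nat -> R) (k h : nat) :
  \sum_(0 <= j < k * h) F j =
  \sum_(0 <= r < k) \sum_(r * h <= j < r.+1 * h) F j.
Proof.
elim: k => [|k IH]; first by rewrite !big_geq.
rewrite (@big_cat_nat _ _ _ (k * h)%N) //=; last by rewrite leq_mul.
by rewrite big_nat_recr //= IH.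
Qed.

(** A substitute for conditional independence.  The quotients j %/ b m, m <= n0,
    describe the past.  They are constant on a cell [r h, (r+1) h) unless one of
    them increases inside it, and their total increase telescopes, so few cells
    are bad; on a bad cell F <= 1 is all that is used. *)
Lemma sum_decouple (b : nat -> nat) (k h n0 : nat) (F G : nat -> R) :
  (forall j, F j <= 1) -> (forall j, 0 <= G j) ->
  (forall r, (r < k)%N ->
     (forall m, (1 <= m <= n0)%N -> ((r * h) %/ b m = (r.+1 * h).-1 %/ b m)%N) ->
     \sum_(r * h <= j < r.+1 * h) F j <= \sum_(r * h <= j < r.+1 * h) G j) ->
  \sum_(0 <= j < k * h) F j <= \sum_(0 <= j < k * h) G j +
    h%:R * \sum_(1 <= m < n0.+1) ((k * h) %/ b m)%N%:R.
Proof.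
move=> F1 G0 good.
pose D r m : R := ((r.+1 * h) %/ b m)%N%:R - ((r * h) %/ b m)%N%:R.
have D0 r m : 0 <= D r m.
  by rewrite subr_ge0 ler_nat leq_div2r // leq_mul.
have -> : \sum_(1 <= m < n0.+1) ((k * h) %/ b m)%N%:R =
    \sum_(0 <= r < k) \sum_(1 <= m < n0.+1) D r m.
  rewrite exchange_big /=; apply: eq_bigr => m _.
  by rewrite (telescope_sumr (fun r => ((r * h) %/ b m)%N%:R)) // mul0n div0n subr0.
rewrite !sum_cells mulr_sumr -big_split /= !big_mkord.
apply: ler_sum => -[r rk] _ /=.
have [goodr|] := boolP (all (fun m => (r * h) %/ b m == (r.+1 * h).-1 %/ b m)%N
                         (index_iota 1 n0.+1)).
  rewrite -[leLHS]addr0 lerD //; last first.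
    by rewrite mulr_ge0 // sumr_ge0.
  apply: good => // m mn0; apply/eqP.
  by move/allP: goodr; apply; rewrite mem_index_iota ltnS.
move=> /allPn[m]; rewrite mem_index_iota ltnS => mn0 bad.
have D1 : 1 <= D r m.
  rewrite /D lerBrDr -(natrD _ 1) ler_nat add1n.
  have h1 : (r * h <= (r.+1 * h).-1)%N.
    by case: (posnP h) => [->|h0]; rewrite ?muln0 // mulSn; lia.
  apply: leq_trans (leq_div2r (b m) (leq_pred (r.+1 * h))).
  by rewrite ltn_neqAle bad leq_div2r.
apply: (@le_trans _ _ h%:R).
  apply: (@le_trans _ _ (\sum_(r * h <= j < r.+1 * h) 1)).
    by apply: ler_sum.
  by rewrite big_const_nat iter_addr_0 -mulnBl subSnn mul1n.
rewrite -[leLHS]add0r lerD ?sumr_ge0 //.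
rewrite ler_peMr // (bigD1_seq m) ?iota_uniq ?mem_index_iota ?ltnS //=.
by rewrite -[leLHS]addr0 lerD ?sumr_ge0.
Qed.

End Decoupling.

(** * Second moment of the number of visits *)

Section SecondMoment.
Variable R : realFieldType.

Lemma sqr_sum_pairs (x : nat -> R) (p L : nat) :
  (\sum_(p <= n < p + L) x n) ^+ 2 =
  \sum_(p <= n < p + L) x n ^+ 2 +
  2 * \sum_(p <= m < p + L) \sum_(m.+1 <= n < p + L) x m * x n.
Proof.
elim: L => [|L IH]; first by rewrite addn0 !big_geq //; ring.
rewrite addnS 3?big_nat_recr ?leq_addr //= sqrrD IH.
rewrite [\sum_((p + L).+1 <= _ < _) _]big_geq // addr0.
have -> : \sum_(p <= m < p + L) \sum_(m.+1 <= n < (p + L).+1) x m * x n =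
  \sum_(p <= m < p + L) \sum_(m.+1 <= n < p + L) x m * x n +
  (\sum_(p <= m < p + L) x m) * x (p + L)%N.
  rewrite mulr_suml -big_split /=; apply: eq_big_nat => m /andP[_ mpL].
  by rewrite big_nat_recr.
ring.
Qed.

Lemma divn_ler (m d : nat) : (m %/ d)%N%:R <= m%:R / d%:R :> R.
Proof.
case: d => [|d]; first by rewrite divn0 invr0 mulr0.
by rewrite ler_pdivlMr ?ltr0n // -natrM ler_nat leq_divM.
Qed.

Lemma divn_gtr (m d : nat) : (0 < d)%N -> m%:R / d%:R - 1 <= (m %/ d)%N%:R :> R.
Proof.
move=> d0; rewrite lerBlDr ler_pdivrMr ?ltr0n // natr1 -natrM ler_nat ltnW //.
exact: ltn_ceil.
Qed.

(** The second moment method: if S is the number of visits, the indicator of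
    S = 0 is at most (1 - S / kap)^2, and kap is chosen close to E S^2 / E S.  The
    diagonal contributes 1 to it, the correlations 2 gam, and the independence
    of the other pairs L * del. *)
Lemma comb_missed_le (P T d : nat -> nat) (del gam eta : R) (p L s h : nat) :
  (forall n, (p <= n < p + L)%N ->
    [/\ (0 < P n)%N, (T n <= P n)%N, (T n)%:R = del * (P n)%:R &
        (P n)%:R <= eta * h%:R]) ->
  0 <= del -> 0 <= gam ->
  \sum_(p <= m < p + L) \sum_(m.+1 <= n < p + L) (P n)%:R / (P m)%:R
    <= L%:R * gam ->
  \sum_(s <= j < s + h)
     (all (fun n => ~~ ((j + d n) %% P n < T n)%N) (index_iota p (p + L)))%:R
  <= h%:R * (1 - L%:R * del / (1 + 2 * gam + L%:R * del) * (1 - 4 * eta)).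
Proof.
move=> HP del0 gam0 Hgam; set kap := 1 + 2 * gam + _.
have Ld0 : 0 <= L%:R * del by rewrite mulr_ge0.
have kap1 : 1 <= kap by rewrite /kap; lra.
have kap0 : 0 < kap by lra.
pose x n j : R := ((j + d n) %% P n < T n)%N%:R.
pose S j := \sum_(p <= n < p + L) x n j.
have [L0|L0] := posnP L.
  rewrite L0 mul0r mul0r mul0r subr0 mulr1 addn0.
  under eq_bigr do rewrite /index_iota subnn /=.
  by rewrite big_const_nat iter_addr_0 addKn.
have C0 : 0 <= h%:R * (1 + 2 * eta) * del.
  have [] := HP p; first by lia.
  move=> P0 _ _ Pe; have : 0 <= eta * h%:R by apply: le_trans Pe.
  by move=> eh; rewrite mulr_ge0 //; have : 0 <= h%:R :> R by []; lra.
have x2 n j : x n j ^+ 2 = x n j by rewrite /x; case: (_ < _)%N; rewrite ?expr1n ?expr0n.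
have lo n : (p <= n < p + L)%N ->
    del * h%:R * (1 - eta) <= \sum_(s <= j < s + h) x n j.
  move=> /HP[Pn0 TP TE PE].
  have Pr0 : 0 < (P n)%:R :> R by rewrite ltr0n.
  have := @sum_periodic_ge (fun j => (j + d n) %% P n < T n)%N (P n)
    (fun j => congr1 nat_of_bool (modn_run_periodic (P n) (T n) (d n) j)) s h.
  rewrite (sum_run_period _ TP) -(ler_nat R) natr_sum natrM TE.
  apply: le_trans; apply: (@le_trans _ _ (del * (h%:R - (P n)%:R))).
    by rewrite -mulrA ler_wpM2l //; lra.
  have -> : del * (h%:R - (P n)%:R) = (h%:R / (P n)%:R - 1) * (del * (P n)%:R).
    by field; rewrite gt_eqF.
  by rewrite ler_wpM2r ?divn_gtr // mulr_ge0.
have up n : (p <= n < p + L)%N ->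
    \sum_(s <= j < s + h) x n j <= h%:R * (1 + 2 * eta) * del.
  move=> /HP[Pn0 TP TE PE].
  have Pr0 : 0 < (P n)%:R :> R by rewrite ltr0n.
  have := @sum_periodic_le (fun j => (j + d n) %% P n < T n)%N (P n)
    (fun j => congr1 nat_of_bool (modn_run_periodic (P n) (T n) (d n) j)) s h Pn0.
  rewrite (sum_run_period _ TP) -(ler_nat R) natr_sum natrM TE.
  move/le_trans; apply; apply: (@le_trans _ _ ((h%:R + (P n)%:R) * del)); last first.
    by rewrite ler_wpM2r //; lra.
  have -> : (h%:R + (P n)%:R) * del = (h%:R / (P n)%:R + 1) * (del * (P n)%:R).
    by field; rewrite gt_eqF.
  by rewrite ler_wpM2r ?mulr_ge0 // -natr1 lerD2r divn_ler.
have pr m n : (p <= m < p + L)%N -> (p <= n < p + L)%N ->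
    \sum_(s <= j < s + h) x m j * x n j <=
    h%:R * (1 + 2 * eta) * del * (del + (P n)%:R / (P m)%:R).
  move=> /HP[Pm0 TPm TEm PEm] /HP[Pn0 TPn TEn PEn].
  have Pmr0 : 0 < (P m)%:R :> R by rewrite ltr0n.
  have Pnr0 : 0 < (P n)%:R :> R by rewrite ltr0n.
  have := sum_two_runs_le (d m) (d n) s h Pm0 Pn0 TPm TPn.
  rewrite -(ler_nat R) natr_sum !natrM TEn.
  under eq_bigr do rewrite natrM.
  move/le_trans; apply.
  apply: (@le_trans _ _ ((h%:R + 2 * (P m)%:R) * del * (del + (P n)%:R / (P m)%:R))); last first.
    rewrite ler_wpM2r ?addr_ge0 ?divr_ge0 // ler_wpM2r //; lra.
  have -> : (h%:R + 2 * (P m)%:R) * del * (del + (P n)%:R / (P m)%:R) =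
    (h%:R / (P m)%:R + 2) * ((del * (P m)%:R / (P n)%:R + 1) * (del * (P n)%:R)).
    by field; rewrite !gt_eqF.
  rewrite ler_pM ?mulr_ge0 //.
    by rewrite -addn2 natrD lerD2r divn_ler.
  rewrite ler_wpM2r ?mulr_ge0 // -natr1 lerD2r (le_trans (divn_ler _ _)) //.
  by rewrite TEm.
have SA : L%:R * (del * h%:R * (1 - eta)) <= \sum_(s <= j < s + h) S j.
  rewrite /S exchange_big /= -[X in X * _](_ : \sum_(p <= n < p + L) 1 = _); last first.
    by rewrite big_const_nat iter_addr_0 addKn.
  by rewrite mulr_suml; apply: ler_sum_nat => n pn; rewrite mul1r lo.
have SB : \sum_(s <= j < s + h) S j ^+ 2 <=
    h%:R * (1 + 2 * eta) * (L%:R * del) * kap.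
  under eq_bigr do rewrite /S sqr_sum_pairs.
  rewrite big_split /= -mulr_sumr exchange_big /= [X in 2 * X]exchange_big /=.
  have B1 : \sum_(p <= n < p + L) \sum_(s <= j < s + h) x n j ^+ 2 <=
      L%:R * (h%:R * (1 + 2 * eta) * del).
    rewrite -[X in X * _](_ : \sum_(p <= n < p + L) 1 = _); last first.
      by rewrite big_const_nat iter_addr_0 addKn.
    rewrite mulr_suml; apply: ler_sum_nat => n pn; rewrite mul1r.
    by under eq_bigr do rewrite x2; exact: up.
  have B2 : \sum_(p <= m < p + L) \sum_(s <= j < s + h)
       \sum_(m.+1 <= n < p + L) x m j * x n j <=
      h%:R * (1 + 2 * eta) * del *
        (del * \sum_(p <= m < p + L) \sum_(m.+1 <= n < p + L) 1 + L%:R * gam).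
    apply: (@le_trans _ _ (h%:R * (1 + 2 * eta) * del *
      \sum_(p <= m < p + L) \sum_(m.+1 <= n < p + L) (del + (P n)%:R / (P m)%:R))).
      rewrite mulr_sumr; apply: ler_sum_nat => m pm.
      rewrite exchange_big /= mulr_sumr; apply: ler_sum_nat => n pn.
      by apply: pr => //; lia.
    rewrite ler_wpM2l // mulr_sumr.
    under [X in X <= _]eq_bigr do rewrite big_split /=.
    rewrite big_split /= lerD //.
    by under [X in _ <= X]eq_bigr do rewrite mulr_sumr; under [X in _ <= X]eq_bigr do under eq_bigr do rewrite mulr1.
  have L2 : 2 * \sum_(p <= m < p + L) \sum_(m.+1 <= n < p + L) 1 = L%:R ^+ 2 - L%:R :> R.
    have := sqr_sum_pairs (fun=> 1) p L.
    rewrite (_ : \sum_(p <= n < p + L) 1 = L%:R); last first.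
      by rewrite big_const_nat iter_addr_0 addKn.
    rewrite (_ : \sum_(p <= n < p + L) 1 ^+ 2 = L%:R); last first.
      under eq_bigr do rewrite expr1n.
      by rewrite big_const_nat iter_addr_0 addKn.
    under [X in 2 * X]eq_bigr do under eq_bigr do rewrite mulr1.
    lra.
  apply: le_trans (lerD B1 (ler_wpM2l _ B2)) _ => //.
  set C := h%:R * _ * del in C0 *; set Pr := \sum_(p <= m < _) _ in L2 *.
  have -> : h%:R * (1 + 2 * eta) * (L%:R * del) * kap = C * (L%:R * kap).
    by rewrite /C; ring.
  have -> : L%:R * C + 2 * (C * (del * Pr + L%:R * gam)) =
    C * (L%:R + del * (2 * Pr) + 2 * (L%:R * gam)) by ring.
  rewrite ler_wpM2l // L2 -subr_ge0.
  suff -> : L%:R * kap - (L%:R + del * (L%:R ^+ 2 - L%:R) + 2 * (L%:R * gam)) =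
    L%:R * del by [].
  by rewrite /kap; ring.
apply: (@le_trans _ _ (\sum_(s <= j < s + h) (1 - kap^-1 * S j) ^+ 2)).
  apply: ler_sum => j _; case: allP => [nohit|_]; last exact: sqr_ge0.
  rewrite /S big1_seq ?mulr0 ?subr0 ?expr1n // => n /= pn.
  by rewrite /x (negbTE (nohit n pn)).
have -> : \sum_(s <= j < s + h) (1 - kap^-1 * S j) ^+ 2 =
   h%:R - 2 * kap^-1 * \sum_(s <= j < s + h) S j +
     kap^-1 ^+ 2 * \sum_(s <= j < s + h) S j ^+ 2.
  rewrite !mulr_sumr -[h%:R in RHS](_ : \sum_(s <= j < s + h) 1 = _); last first.
    by rewrite big_const_nat iter_addr_0 addKn.
  rewrite -sumrB -big_split /=; apply: eq_bigr => j _; ring.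
have k0 : 0 < kap^-1 by rewrite invr_gt0.
apply: (@le_trans _ _ (h%:R - 2 * kap^-1 * (L%:R * (del * h%:R * (1 - eta))) +
     kap^-1 ^+ 2 * (h%:R * (1 + 2 * eta) * (L%:R * del) * kap))).
  rewrite lerD ?lerB ?ler_wpM2l ?sqr_ge0 //; lra.
rewrite le_eqVlt; apply/orP; left; apply/eqP; field; lra.
Qed.

End SecondMoment.

(** * Counting in the discrete model *)

(** The cell of the circle that contains the n-th point, when x = (j + u) / Q with
    0 <= u < 1. *)
Definition digit (b : nat -> nat) (M n j : nat) : nat := ((j %/ b n) %% M)%N.

(** The n-th point lies in the arc of t consecutive cells that starts at cell i.
    Shifting by (M - i) cells moves the arc to the start of the period, so that
    arcs across 0 are no special case. *)
Definition arc_hit (b : nat -> nat) (M t i n j : nat) : bool :=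
  ((j + (M - i) * b n) %% (M * b n) < t * b n)%N.

Lemma arc_hitE (b : nat -> nat) (M t i n j : nat) : (0 < b n)%N ->
  arc_hit b M t i n j = ((j %/ b n + (M - i)) %% M < t)%N.
Proof.
move=> b0; rewrite /arc_hit -ltn_divLR // [(M * _)%N]mulnC divn_modl ?dvdn_mulr //.
by rewrite mulKn // divnDr ?dvdn_mull // mulnK.
Qed.

Section Model.
Variables (R : realType) (a b : nat -> nat) (N M w Q : nat).
Hypothesis M0 : (0 < M)%N.
Hypothesis w0 : (0 < w)%N.
Hypothesis b0 : forall n, (1 <= n <= N)%N -> (0 < b n)%N.
Hypothesis a0 : forall n, (1 <= n <= N)%N -> (0 < a n)%N.
Hypothesis QE : forall n, (1 <= n <= N)%N -> Q = (a n * (M * b n))%N.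
Hypothesis wb : forall n, (1 <= n <= N)%N -> (w %| b n)%N.
Hypothesis a_mono : forall m n, (1 <= m)%N -> (m <= n)%N -> (n <= N)%N -> (a m <= a n)%N.

(** The length of the cells on which the first n points are frozen: finer than
    b n by a factor w, so that few cells are cut by the coarser scales b m. *)
Definition mesh n := (b n %/ w)%N.

Lemma mesh_gt0 n : (1 <= n <= N)%N -> (0 < mesh n)%N.
Proof. by move=> nN; rewrite divn_gt0 // dvdn_leq ?b0 ?wb. Qed.

(** The total number of jumps of the scales b m, m <= n0, is at most
    n0 * M * a n0, while there are w * M * a n0 cells; their ratio gives the
    error N / w. *)
Lemma mesh_decouple (n0 : nat) (F G : nat -> R) :
  (1 <= n0 <= N)%N -> (forall j, F j <= 1) -> (forall j, 0 <= G j) ->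
  (forall r, (forall j m, (r * mesh n0 <= j < r.+1 * mesh n0)%N -> (1 <= m <= n0)%N ->
      (j %/ b m = (r * mesh n0) %/ b m)%N) ->
     \sum_(r * mesh n0 <= j < r.+1 * mesh n0) F j <=
     \sum_(r * mesh n0 <= j < r.+1 * mesh n0) G j) ->
  \sum_(0 <= j < Q) F j <= \sum_(0 <= j < Q) G j + Q%:R * (N%:R / w%:R).
Proof.
move=> n0N F1 G0 good; have h0 := mesh_gt0 n0N; set h := mesh n0 in h0 good *.
have hw : (h * w = b n0)%N by rewrite divnK ?wb.
have QE0 : Q = (a n0 * M * w * h)%N by rewrite (QE n0N) -hw; lia.
have hQ : Q = (Q %/ h * h)%N by rewrite {2}QE0 mulnK.
rewrite [in leLHS]hQ [X in _ <= \sum_(0 <= j < X) _ + _]hQ.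
apply: (@le_trans _ _ (\sum_(0 <= j < Q %/ h * h) G j +
   h%:R * \sum_(1 <= m < n0.+1) ((Q %/ h * h) %/ b m)%N%:R)).
  apply: sum_decouple => // r rk cst; apply: good => j m jr mn0.
  have h1 : ((r.+1 * h).-1 %/ b m = (r * h) %/ b m)%N by rewrite -cst.
  apply/eqP; rewrite eqn_leq -{1}h1 !leq_div2r //; first by case/andP: jr.
  by case/andP: jr; lia.
rewrite lerD2l -hQ.
apply: (@le_trans _ _ (h%:R * (n0 * (M * a n0))%:R)).
  rewrite ler_wpM2l // -natr_sum ler_nat.
  have {2}-> : n0 = (n0.+1 - 1)%N by lia.
  rewrite -sum_nat_const_nat big_nat_cond [leqRHS]big_nat_cond.
  apply: leq_sum => m; rewrite andbT ltnS => /andP[m1 mn0].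
  have mN : (1 <= m <= N)%N by lia.
  rewrite (QE mN) mulnA mulnK ?b0 // mulnC leq_mul2l a_mono ?orbT //; lia.
rewrite mulrA ler_pdivlMr ?ltr0n // -!natrM ler_nat {1}QE0.
have : (n0 <= N)%N by lia.
move=> /(leq_mul (leqnn (a n0 * M * w * h))); lia.
Qed.

Section Lag.
Variables (g : nat) (G eta : R).
Hypothesis growth : forall m, (1 <= m)%N -> (m + g <= N)%N ->
  G * (a m)%:R <= (a (m + g)%N)%:R.
Hypothesis G0 : 0 < G.
Hypothesis meshG : (M * w)%:R <= eta * G.

Lemma eta_ge0 : 0 <= eta.
Proof.
have : 0 <= eta * G by apply: le_trans meshG.
by rewrite pmulr_lge0.
Qed.

(** After a lag g the points run through the whole circle many times inside each
    cell of the mesh. *)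
Lemma mesh_coarse n0 n : (1 <= n0)%N -> (n0 + g <= n)%N -> (n <= N)%N ->
  (M * b n)%:R <= eta * (mesh n0)%:R.
Proof.
move=> n01 n0n nN.
have n0N : (1 <= n0 <= N)%N by lia.
have nN' : (1 <= n <= N)%N by lia.
have ga : G * (a n0)%:R <= (a n)%:R.
  by rewrite (le_trans (growth n01 _)) ?ler_nat ?a_mono //; lia.
have hw : (mesh n0 * w = b n0)%N by rewrite divnK ?wb.
have E : ((a n0)%:R * ((M * w)%:R * (mesh n0)%:R) = (a n)%:R * (M * b n)%:R :> R).
  rewrite -!natrM -(QE nN'); congr (_%:R).
  by rewrite (QE n0N) -hw; lia.
have an0 : 0 < (a n)%:R :> R by rewrite ltr0n a0.
rewrite -(ler_pM2l an0) -E.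
apply: (@le_trans _ _ ((a n0)%:R * (eta * G * (mesh n0)%:R))).
  by rewrite ler_wpM2l // ler_wpM2r.
rewrite (_ : _ * _ = G * (a n0)%:R * (eta * (mesh n0)%:R)); last by ring.
by rewrite ler_wpM2r // mulr_ge0 // eta_ge0.
Qed.

End Lag.

Section Upper.
Variables (t i L g : nat) (G eta gam : R).
Hypothesis tM : (t <= M)%N.
Hypothesis L0 : (0 < L)%N.
Hypothesis g0 : (0 < g)%N.
Hypothesis growth : forall m, (1 <= m)%N -> (m + g <= N)%N ->
  G * (a m)%:R <= (a (m + g)%N)%:R.
Hypothesis G0 : 0 < G.
Hypothesis meshG : (M * w)%:R <= eta * G.
Hypothesis eta4 : eta <= 1 / 4.
Hypothesis gam0 : 0 <= gam.
Hypothesis Hgam : forall p, (1 <= p)%N ->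
  \sum_(p <= m < p + L) \sum_(m.+1 <= n < p + L) (a m)%:R / (a n)%:R <= L%:R * gam.

Let del : R := t%:R / M%:R.
Let rate : R := L%:R * del / (1 + 2 * gam + L%:R * del) * (1 - 4 * eta).
Let block k := index_iota (k * (L + g)).+1 ((k * (L + g)).+1 + L).
Let miss k j := all (fun k' => all (fun n => ~~ arc_hit b M t i n j) (block k')) (iota 0 k).

Lemma rate_bounds : 0 <= rate <= 1.
Proof.
have e0 := eta_ge0 G0 meshG; have gam0' := gam0; have eta4' := eta4.
have d0 : 0 <= L%:R * del by rewrite mulr_ge0 // divr_ge0.
rewrite /rate; set y := L%:R * del in d0 *; have k0 : 0 < 1 + 2 * gam + y by lra.
have x0 : 0 <= y / (1 + 2 * gam + y) <= 1.
  by rewrite divr_ge0 ?(ltW k0) //= ler_pdivrMr // mul1r; lra.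
move: x0; set x := y / _ => /andP[x0 x1].
rewrite mulr_ge0 //=; last by lra.
rewrite mulr_ile1 //; lra.
Qed.

(** On a cell where the past is frozen, the block visits the arc with relative
    frequency at least rate by the second moment bound.  The lag g before the
    block makes its periods short compared with the cell. *)
Lemma miss_step k : (1 <= k)%N -> (k.+1 * (L + g) <= N)%N ->
  \sum_(0 <= j < Q) (miss k.+1 j)%:R <=
  (1 - rate) * \sum_(0 <= j < Q) (miss k j)%:R + Q%:R * (N%:R / w%:R) :> R.
Proof.
move=> k1 kN; have /andP[r0 r1] := rate_bounds.
(* The last index of the preceding block. *)
pose n0 := (k * (L + g) - g)%N.
have gk : (L + g <= k * (L + g))%N by rewrite leq_pmull.
have n0N : (1 <= n0 <= N)%N by rewrite /n0; move: kN; rewrite mulSn; lia.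
rewrite mulr_sumr; apply: (mesh_decouple n0N).
- by move=> j; case: miss.
- by move=> j; rewrite mulr_ge0 // subr_ge0.
move=> r cst; set h := mesh n0 in cst *.
have [h0|h0] := posnP h; first by rewrite h0 !muln0 !big_geq.
have cmiss j : (r * h <= j < r.+1 * h)%N -> miss k j = miss k (r * h).
  move=> jr; apply: eq_in_all => k'; rewrite mem_iota /= add0n => k'k.
  apply: eq_in_all => n; rewrite mem_index_iota => nB.
  have nn0 : (1 <= n <= n0)%N.
    have : (k'.+1 * (L + g) <= k * (L + g))%N by rewrite leq_mul.
    by rewrite /n0; move: nB; rewrite mulSn; lia.
  have nN : (1 <= n <= N)%N by lia.
  by rewrite !arc_hitE ?b0 // (cst _ _ jr nn0).
have missS j : miss k.+1 j = miss k j && all (fun n => ~~ arc_hit b M t i n j) (block k).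
  by rewrite /miss -addn1 iotaD all_cat /= andbT add0n.
rewrite -mulr_sumr.
case E : (miss k (r * h)); last first.
  rewrite big_nat_cond big1 => [|j]; last first.
    by rewrite andbT => jr; rewrite missS cmiss // E.
  by rewrite mulr_ge0 ?subr_ge0 // sumr_ge0.
have -> : \sum_(r * h <= j < r.+1 * h) (miss k j)%:R = h%:R :> R.
  under eq_big_nat => j jr do rewrite cmiss // E.
  by rewrite big_const_nat iter_addr_0 -mulnBl subSnn mul1n.
rewrite mulrC.
have -> : (r.+1 * h = r * h + h)%N by rewrite mulSn addnC.
have -> : \sum_(r * h <= j < r * h + h) (miss k.+1 j)%:R =
   \sum_(r * h <= j < r * h + h) (all (fun n =>
     ~~ ((j + (M - i) * b n) %% (M * b n) < t * b n)%N) (block k))%:R :> R.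
  apply: eq_big_nat => j jr; rewrite missS cmiss ?E //.
  by rewrite mulSn [(h + _)%N]addnC.
apply: (comb_missed_le (P := fun n => (M * b n)%N) (T := fun n => (t * b n)%N)) => //.
- move=> n nB; have nN : (1 <= n <= N)%N by move: kN; rewrite mulSn; lia.
  split.
  + by rewrite muln_gt0 M0 b0.
  + by rewrite leq_mul.
  + rewrite !natrM /del mulrA divfK // pnatr_eq0; lia.
  + by apply: (mesh_coarse growth G0 meshG); rewrite /n0; lia.
- by rewrite divr_ge0.
- apply: le_trans (Hgam (p := (k * (L + g)).+1) isT).
  rewrite big_nat_cond [leRHS]big_nat_cond.
  apply: ler_sum => m; rewrite andbT => mB.
  rewrite big_nat_cond [leRHS]big_nat_cond.
  apply: ler_sum => n; rewrite andbT => nB.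
  have nN : (1 <= n <= N)%N by move: kN; rewrite mulSn; lia.
  have mN : (1 <= m <= N)%N by lia.
  have E2 : (a n * (M * b n) = a m * (M * b m))%N by rewrite -QE // -QE.
  rewrite ler_pdivrMr ?ltr0n ?muln_gt0 ?M0 ?b0 // mulrAC.
  rewrite ler_pdivlMr ?ltr0n ?a0 // -!natrM ler_nat; lia.
Qed.

(** The first block has no past to decouple from and is bounded trivially,
    whence the exponent k for k.+1 blocks. *)
Lemma miss_blocks k : (k.+1 * (L + g) <= N)%N ->
  \sum_(0 <= j < Q) (miss k.+1 j)%:R <=
  Q%:R * ((1 - rate) ^+ k + k%:R * (N%:R / w%:R)) :> R.
Proof.
have /andP[r0 r1] := rate_bounds.
have e0 : 0 <= N%:R / w%:R :> R by rewrite divr_ge0.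
elim: k => [|k IH] kN.
  rewrite expr0 mul0r addr0 mulr1.
  apply: (@le_trans _ _ (\sum_(0 <= j < Q) 1)); first by apply: ler_sum => j _; case: miss.
  by rewrite big_const_nat iter_addr_0 subn0.
have kN' : (k.+1 * (L + g) <= N)%N by move: kN; rewrite mulSn; lia.
apply: le_trans (miss_step _ kN) _ => //.
apply: (@le_trans _ _ ((1 - rate) * (Q%:R * ((1 - rate) ^+ k + k%:R * (N%:R / w%:R))) +
   Q%:R * (N%:R / w%:R))).
  by rewrite lerD2r ler_wpM2l ?IH // subr_ge0.
rewrite exprS -natr1 mulrCA -mulrDr ler_wpM2l //.
have : 0 <= k%:R * (N%:R / w%:R) :> R by rewrite mulr_ge0.
set y := N%:R / _ in e0 *; set x := k%:R * y => x0.
have : 0 <= rate * x by rewrite mulr_ge0.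
set z := rate * x; set p := (1 - rate) ^+ k; move=> z0.
have -> : (1 - rate) * (p + x) + y = (1 - rate) * p + (k%:R + 1) * y - z.
  by rewrite /z /x; ring.
by rewrite lerBlDr lerDl.
Qed.

Lemma missed_arc_count k : (k.+1 * (L + g) <= N)%N ->
  \sum_(0 <= j < Q) (all (fun n => ~~ arc_hit b M t i n j) (index_iota 1 N.+1))%:R <=
  Q%:R * ((1 - rate) ^+ k + k%:R * (N%:R / w%:R)) :> R.
Proof.
move=> kN; apply: le_trans (miss_blocks kN); apply: ler_sum => j _.
rewrite ler_nat; case: allP => // H.
rewrite (_ : miss _ _ = true) //; apply/allP => k'; rewrite mem_iota add0n => k'k.
apply/allP => n; rewrite mem_index_iota => nB; apply: H; rewrite mem_index_iota.
have : (k'.+1 * (L + g) <= k.+1 * (L + g))%N by rewrite leq_mul //; lia.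
by rewrite mulSn; lia.
Qed.

End Upper.
Section Lower.

Definition fresh (n j v : nat) : bool := all (fun m => digit b M m j != v) (iota 1 n).
Definition nfresh (n j : nat) : nat := (\sum_(0 <= v < M) fresh n j v)%N.

Lemma digit_lt n j : (digit b M n j < M)%N.
Proof. by rewrite ltn_mod. Qed.

Lemma freshS n j v : fresh n.+1 j v = fresh n j v && (digit b M n.+1 j != v).
Proof. by rewrite /fresh -(addn1 n) iotaD all_cat /= andbT add1n addn1. Qed.

Lemma fresh_mono n k j v : fresh (n + k) j v -> fresh n j v.
Proof. by rewrite /fresh iotaD all_cat => /andP[]. Qed.

(** Each step visits one cell, so the number of unvisited cells drops by one or
    not at all. *)
Lemma nfreshS n j : (nfresh n.+1 j + fresh n j (digit b M n.+1 j) = nfresh n j)%N.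
Proof.
rewrite /nfresh !big_mkord (bigD1 (Ordinal (digit_lt n.+1 j))) //=.
rewrite [RHS](bigD1 (Ordinal (digit_lt n.+1 j))) //= freshS eqxx andbF add0n addnC.
congr (_ + _)%N; apply: eq_bigr => v vd; rewrite freshS.
suff -> : digit b M n.+1 j != v by rewrite andbT.
by apply: contra vd => /eqP e; apply/eqP/val_inj.
Qed.

Lemma nfresh_le n k j : (nfresh (n + k) j <= nfresh n j <= nfresh (n + k) j + k)%N.
Proof.
elim: k => [|k IH]; first by rewrite !addn0 leqnn.
by have := nfreshS (n + k) j; rewrite addnS; case: fresh => /=; lia.
Qed.

Lemma nfresh0 j : nfresh 0 j = M.
Proof. by rewrite /nfresh sum_nat_const_nat subn0 muln1. Qed.

Variables (g : nat) (G eta : R).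
Hypothesis growth : forall m, (1 <= m)%N -> (m + g.+1 <= N)%N ->
  G * (a m)%:R <= (a (m + g.+1)%N)%:R.
Hypothesis G0 : 0 < G.
Hypothesis meshG : (M * w)%:R <= eta * G.
Hypothesis eta2 : eta <= 1 / 2.

Let phi n (th : R) : R := \sum_(0 <= j < Q) expR (- (th * (nfresh n j)%:R)).

Lemma phi_ge0 n th : 0 <= phi n th.
Proof. by apply: sumr_ge0 => *; exact: expR_ge0. Qed.

(** On a cell of the mesh the set of unvisited cells of the circle is fixed, and
    a later point falls into it with frequency close to its measure. *)
Lemma fresh_hits_le (n0 n r : nat) : (1 <= n0)%N -> (n0 + g.+1 <= n)%N -> (n <= N)%N ->
  (forall j m, (r * mesh n0 <= j < r.+1 * mesh n0)%N -> (1 <= m <= n0)%N ->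
      (j %/ b m = (r * mesh n0) %/ b m)%N) ->
  \sum_(r * mesh n0 <= j < r.+1 * mesh n0) (fresh n0 j (digit b M n j))%:R <=
  (mesh n0)%:R * ((1 + eta) / M%:R * (nfresh n0 (r * mesh n0))%:R) :> R.
Proof.
move=> n01 n0n nN; set h := mesh n0 => cst.
have nN' : (1 <= n <= N)%N by lia.
have Pe := mesh_coarse growth G0 meshG n01 n0n nN.
have cfresh j v : (r * h <= j < r.+1 * h)%N -> fresh n0 j v = fresh n0 (r * h) v.
  move=> jr; apply: eq_in_all => m; rewrite mem_iota => mB.
  by rewrite /digit (cst _ _ jr) //; lia.
pose f j : nat := fresh n0 (r * h) (digit b M n j).
have fP j : f (j + M * b n)%N = f j.
  by rewrite /f /digit divnDr ?dvdn_mull // mulnK ?b0 // modnDr.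
have fsum : (\sum_(0 <= j < M * b n) f j = b n * nfresh n0 (r * h))%N.
  by rewrite (sum_digit_period (fun v => fresh n0 (r * h) v : nat)) ?b0.
have -> : \sum_(r * h <= j < r.+1 * h) (fresh n0 j (digit b M n j))%:R =
    (\sum_(r * h <= j < r * h + h) f j)%N%:R :> R.
  rewrite natr_sum mulSn addnC; apply: eq_big_nat => j jr; rewrite cfresh //.
  by rewrite mulSn addnC.
have P0 : (0 < M * b n)%N by rewrite muln_gt0 M0 b0.
have := sum_periodic_le fP (r * h) h P0.
rewrite -(ler_nat R) natrM fsum => /le_trans; apply.
have Pr0 : 0 < (M * b n)%:R :> R by rewrite ltr0n.
have Mr0 : M%:R != 0 :> R by rewrite pnatr_eq0; lia.
apply: (@le_trans _ _ ((h%:R / (M * b n)%:R + 1) * (b n * nfresh n0 (r * h))%:R)).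
  by rewrite ler_wpM2r // -natr1 lerD2r divn_ler.
have -> : (h%:R / (M * b n)%:R + 1) * (b n * nfresh n0 (r * h))%:R =
  (h%:R + (M * b n)%:R) * (M%:R^-1 * (nfresh n0 (r * h))%:R) :> R.
  rewrite !natrM; field; rewrite Mr0 /= pnatr_eq0; have := b0 nN'; lia.
have -> : h%:R * ((1 + eta) / M%:R * (nfresh n0 (r * h))%:R) =
  (h%:R + eta * h%:R) * (M%:R^-1 * (nfresh n0 (r * h))%:R) by field.
by rewrite ler_wpM2r ?lerD2l.
Qed.

(** One step of the exponential potential.  The step from n0 + g to n0 + g.+1
    visits a fresh cell only if it visits one that was fresh at time n0, and the
    frequency of this is controlled by decoupling at time n0.  Passing between
    the times n0 and n0 + g changes the count by at most g, which costs factors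
    exp (th * g); they are harmless because th * g is small.  The resulting
    factor 1 + 2 th / M * (Z + g) is absorbed by lowering th. *)
Lemma phi_step n0 (th : R) : (1 <= n0)%N -> (n0 + g.+1 <= N)%N -> 0 <= th ->
  th * g.+1%:R <= 1 / 4 ->
  phi (n0 + g.+1)%N th <=
  expR (2 * th / M%:R * g%:R) * phi (n0 + g)%N (th * (1 - 2 / M%:R)) +
    Q%:R * (N%:R / w%:R).
Proof.
move=> n01 nN th0 thg.
have e0 := eta_ge0 G0 meshG; have eta2' := eta2.
(* The increase of exp (- th * Z) at a visit, measured against its value at the
   earlier time n0. *)
pose kap := (expR th - 1) * expR (th * g%:R).
have kap0 : 0 <= kap.
  by rewrite mulr_ge0 ?expR_ge0 // subr_ge0 -expR0 ler_expR.
have kap_th : kap <= 4 / 3 * th.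
  apply: (@le_trans _ _ (th * expR (th * g.+1%:R))).
    rewrite /kap -natr1 mulrDr mulr1 expRD mulrA mulrAC ler_wpM2r ?expR_ge0 //.
    have := expR_ge1Dx (- th); rewrite expRN => h1.
    have E : expR th * (expR th)^-1 = 1 by rewrite mulfV // gt_eqF ?expR_gt0.
    have := ler_wpM2l (expR_ge0 th) h1; rewrite E; lra.
  rewrite mulrC ler_wpM2r //.
  have := expR_ge1Dx (- (th * g.+1%:R)); rewrite expRN => h1.
  set x := expR _ in h1 *; have x0 : 0 < x by rewrite expR_gt0.
  have E : x * x^-1 = 1 by rewrite mulfV // gt_eqF.
  have h2 : 3 / 4 <= x^-1 by lra.
  have := ler_wpM2l (ltW x0) h2; rewrite E; lra.
have kap1 : kap <= 1.
  have : th * 1 <= th * g.+1%:R by rewrite ler_wpM2l // ler1n.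
  lra.
have M0r : 0 < M%:R :> R by rewrite ltr0n.
pose F j : R := expR (- (th * (nfresh n0 j)%:R)) * (fresh n0 j (digit b M (n0 + g.+1) j))%:R.
pose H j : R := expR (- (th * (nfresh n0 j)%:R)) * ((1 + eta) / M%:R * (nfresh n0 j)%:R).
have n0N : (1 <= n0 <= N)%N by rewrite n01 (leq_trans (leq_addr _ _) nN).
have dec : \sum_(0 <= j < Q) F j <= \sum_(0 <= j < Q) H j + Q%:R * (N%:R / w%:R).
  apply: (mesh_decouple n0N).
  - move=> j; rewrite /F mulr_ile1 ?expR_ge0 //; last by case: fresh.
    by rewrite -expR0 ler_expR oppr_le0 mulr_ge0.
  - by move=> j; rewrite /H !mulr_ge0 ?expR_ge0 ?invr_ge0 //; lra.
  move=> r cst; set h := mesh n0 in cst *.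
  have cZ j : (r * h <= j < r.+1 * h)%N -> nfresh n0 j = nfresh n0 (r * h).
    move=> jr; apply: eq_bigr => v _; congr nat_of_bool.
    apply: eq_in_all => m; rewrite mem_iota => mB.
    by rewrite /digit (cst _ _ jr) //; lia.
  rewrite /F /H.
  under eq_big_nat => j jr do rewrite cZ //.
  under [leRHS]eq_big_nat => j jr do rewrite cZ //.
  rewrite -mulr_sumr -[leRHS]mulr_sumr ler_wpM2l ?expR_ge0 //.
  apply: le_trans (fresh_hits_le n01 (leqnn _) nN cst) _.
  by rewrite big_const_nat iter_addr_0 -mulnBl subSnn mul1n mulr_natl.
have pt j : expR (- (th * (nfresh (n0 + g.+1) j)%:R)) <=
    expR (- (th * (nfresh (n0 + g) j)%:R)) + kap * F j.
  have ZS := nfreshS (n0 + g) j; rewrite -addnS in ZS.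
  have mono : (fresh (n0 + g) j (digit b M (n0 + g.+1) j) <= fresh n0 j (digit b M (n0 + g.+1) j))%N.
    by case E : fresh => //; rewrite (fresh_mono E).
  have /andP[_ Zg] := nfresh_le n0 g j.
  rewrite -ZS in Zg; rewrite /F -{}ZS; move: mono Zg.
  case: (fresh (n0 + g)) => /=; last first.
    by move=> _ _; rewrite addn0 lerDl mulr_ge0 // mulr_ge0 ?expR_ge0.
  case: fresh => // _; rewrite mulr1 natrD mulrDr mulr1 opprD expRD /kap.
  set z := nfresh (n0 + g.+1) j; set z0 := nfresh n0 j => Zg.
  have h1 : expR (- (th * z%:R)) - expR (- (th * z%:R)) * expR (- th) =
      (expR th - 1) * expR (- (th * (z + 1)%:R)).
    rewrite natrD mulrDr mulr1 opprD expRD !expRN; field.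
    by rewrite !gt_eqF ?expR_gt0.
  rewrite -lerBlDl h1 -mulrA ler_wpM2l //.
    by rewrite subr_ge0 -expR0 ler_expR.
  rewrite -expRD ler_expR -mulrBr -[leLHS]mulrN ler_wpM2l //.
  by rewrite lerNl opprB lerBlDr -natrD ler_nat.
apply: (@le_trans _ _ (\sum_(0 <= j < Q)
   (expR (- (th * (nfresh (n0 + g) j)%:R)) + kap * F j))).
  by apply: ler_sum => j _; apply: pt.
rewrite big_split /= -mulr_sumr.
apply: (@le_trans _ _ (\sum_(0 <= j < Q) expR (- (th * (nfresh (n0 + g) j)%:R)) +
   (kap * (\sum_(0 <= j < Q) H j) + Q%:R * (N%:R / w%:R)))).
  rewrite lerD2l (le_trans (ler_wpM2l kap0 dec)) // mulrDr lerD2l.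
  by rewrite ler_piMl // mulr_ge0 // divr_ge0.
rewrite addrA lerD2r mulr_sumr -big_split mulr_sumr /=.
apply: ler_sum => j _; rewrite /H.
have /andP[Zle Zg] := nfresh_le n0 g j.
set z0 := nfresh n0 j in Zle Zg *; set z1 := nfresh (n0 + g) j in Zle Zg *.
have Z1r : (z1%:R <= z0%:R :> R) by rewrite ler_nat.
have Z0r : (z0%:R <= z1%:R + g%:R :> R) by rewrite -natrD ler_nat.
have e1 : expR (- (th * z0%:R)) <= expR (- (th * z1%:R)).
  by rewrite ler_expR lerN2 ler_wpM2l.
have kk : kap * ((1 + eta) / M%:R) <= 2 * th / M%:R.
  rewrite mulrA ler_wpM2r ?invr_ge0 //.
  have := ler_wpM2l kap0 eta2'; have := ler_wpM2r e0 kap_th; lra.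
apply: (@le_trans _ _ (expR (- (th * z1%:R)) * (1 + 2 * th / M%:R * (z1%:R + g%:R)))).
  have eM : 0 <= (1 + eta) / M%:R by rewrite divr_ge0 //; lra.
  rewrite mulrDr mulr1 lerD2l mulrCA ler_pM ?expR_ge0 //.
    by rewrite mulr_ge0 // mulr_ge0.
  by rewrite mulrA ler_pM // mulr_ge0.
apply: (@le_trans _ _ (expR (- (th * z1%:R)) * expR (2 * th / M%:R * (z1%:R + g%:R)))).
  by rewrite ler_wpM2l ?expR_ge0 // expR_ge1Dx.
rewrite -!expRD ler_expR le_eqVlt; apply/orP; left; apply/eqP.
by field; rewrite gt_eqF.
Qed.

Lemma phi_iter k (th : R) : (1 < M)%N -> (k + g.+1 <= N)%N -> 0 <= th ->
  th * g.+1%:R <= 1 / 4 ->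
  phi (g.+1 + k)%N th <=
  expR (2 * th / M%:R * g%:R * k%:R) *
    (phi g.+1 (th * (1 - 2 / M%:R) ^+ k) + k%:R * (Q%:R * (N%:R / w%:R))).
Proof.
move=> M1; elim: k th => [|k IH] th kN th0 thg.
  by rewrite !mulr0 expR0 mul1r mul0r addr0 expr0 mulr1 addn0.
have M0r : 0 < M%:R :> R by rewrite ltr0n.
set e := Q%:R * _ in IH *.
have e0 : 0 <= e by rewrite mulr_ge0 // divr_ge0.
have d1 : (0 <= 1 - 2 / M%:R :> R) && (1 - 2 / M%:R <= 1 :> R).
  rewrite subr_ge0 ler_pdivrMr // mul1r ler_nat M1 /=.
  by rewrite lerBlDr lerDl divr_ge0.
set th' := th * (1 - 2 / M%:R).
have th'0 : 0 <= th' by case/andP: d1 => d1 _; rewrite mulr_ge0.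
have th'th : th' <= th by case/andP: d1 => _ d1; rewrite ler_piMr.
have step := phi_step (n0 := k.+1) isT kN th0 thg.
have IH' : phi (g.+1 + k)%N th' <= expR (2 * th / M%:R * g%:R * k%:R) *
    (phi g.+1 (th' * (1 - 2 / M%:R) ^+ k) + k%:R * e).
  apply: le_trans (IH th' _ th'0 _) _; first by rewrite ltnW // -addSn.
    by apply: le_trans thg; rewrite ler_wpM2r.
  rewrite ler_wpM2r ?addr_ge0 ?phi_ge0 //; first by rewrite mulr_ge0.
  by rewrite ler_expR !ler_wpM2r ?invr_ge0 // ler_wpM2l.
have -> : (g.+1 + k.+1 = k.+1 + g.+1)%N by rewrite addnC.
apply: le_trans step _; have -> : (k.+1 + g = g.+1 + k)%N by rewrite addSnnS addnC.
rewrite -/th' exprS [th * (_ * _)]mulrA -/th' -/e.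
set A := phi g.+1 _ in IH' *.
have -> : expR (2 * th / M%:R * g%:R * k.+1%:R) =
    expR (2 * th / M%:R * g%:R) * expR (2 * th / M%:R * g%:R * k%:R).
  by rewrite -expRD -[k.+1%:R]natr1 mulrDr mulr1 addrC.
set E1 := expR _; set Ek := expR _ in IH' *.
have Ek1 : 1 <= E1 * Ek.
  by rewrite -expRD -expR0 ler_expR addr_ge0 // !mulr_ge0 ?invr_ge0 //.
apply: (@le_trans _ _ (E1 * (Ek * (A + k%:R * e)) + e)).
  by rewrite lerD2r ler_wpM2l ?expR_ge0.
rewrite -natr1 mulrDl mul1r addrA [leRHS]mulrDr mulrA lerD2l.
by rewrite ler_peMl.
Qed.

Lemma all_hit_count (th : R) : (1 < M)%N -> (g.+1 <= N)%N -> (g.+1 <= M)%N -> 0 <= th ->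
  th * g.+1%:R <= 1 / 4 ->
  \sum_(0 <= j < Q) (nfresh N j == 0%N)%:R <=
  Q%:R * (expR (2 * th / M%:R * g%:R * N%:R) *
    (expR (- (th * (1 - 2 / M%:R) ^+ N * (M%:R - g.+1%:R))) + N%:R * (N%:R / w%:R))) :> R.
Proof.
move=> M1 gN gM th0 thg.
have M0r : 0 < M%:R :> R by rewrite ltr0n.
have d0 : 0 <= 1 - 2 / M%:R :> R by rewrite subr_ge0 ler_pdivrMr // mul1r ler_nat.
have d1 : 1 - 2 / M%:R <= 1 :> R by rewrite lerBlDr lerDl divr_ge0.
apply: (@le_trans _ _ (phi N th)).
  apply: ler_sum => j _; case: eqP => [->|_]; last exact: expR_ge0.
  by rewrite mulr0 oppr0 expR0.
have := @phi_iter (N - g.+1) th M1; rewrite subnK // subnKC // => /(_ (leqnn _) th0 thg).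
set k := (N - g.+1)%N; have kN : (k <= N)%N by rewrite /k; lia.
have e0 : 0 <= N%:R / w%:R :> R by rewrite divr_ge0.
move/le_trans; apply; rewrite [leRHS]mulrCA ler_pM ?expR_ge0 //.
- by rewrite addr_ge0 ?phi_ge0 // !mulr_ge0.
- by rewrite ler_expR ler_wpM2l ?ler_nat // !mulr_ge0 ?invr_ge0.
rewrite mulrDr lerD //; last first.
  by rewrite mulrCA ler_wpM2l // ler_wpM2r // ler_nat.
have -> E : Q%:R * E = \sum_(0 <= j < Q) E :> R by rewrite sumr_const_nat subn0 mulr_natl.
apply: ler_sum => j _; rewrite ler_expR lerN2.
have /andP[_ Zg] := nfresh_le 0 g.+1 j; rewrite nfresh0 add0n in Zg.
have Zr : M%:R - g.+1%:R <= (nfresh g.+1 j)%:R :> R.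
  by rewrite lerBlDr -natrD ler_nat.
have Mg : 0 <= M%:R - g.+1%:R :> R by rewrite subr_ge0 ler_nat.
rewrite ler_pM ?mulr_ge0 ?exprn_ge0 //.
by rewrite ler_wpM2l // -(subnKC kN) exprD ler_piMr ?exprn_ge0 // exprn_ile1.
Qed.

End Lower.

End Model.

(** * Arcs, gaps and cells of the circle *)

Section CircleGeometry.
Variable R : realType.
Notation mu := (@lebesgue_measure R).

Lemma lebesgue_le (A B : set R) : A `<=` B -> (mu A <= mu B)%E.
Proof. by move=> AB; apply: le_outer_measure. Qed.

Lemma lebesgue_setU_le (A B : set R) : (mu (A `|` B) <= mu A + mu B)%E.
Proof. exact: outer_measureU2. Qed.

Lemma circle_proj_eq (x : R) (e : int) :
  e%:~R <= x < (e + 1)%:~R -> circle_proj x = x - e%:~R.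
Proof. by move=> h; rewrite /circle_proj; have /eqP -> : Num.floor x == e by rewrite floor_eq. Qed.

Lemma circle_proj_itv (x : R) : 0 <= circle_proj x < 1.
Proof. by have := floor_itv x; rewrite /circle_proj intrD; lra. Qed.

Lemma circle_proj_subz (x : R) (e : int) : circle_proj (x - e%:~R) = circle_proj x.
Proof.
rewrite (@circle_proj_eq (x - e%:~R) (Num.floor x - e)).
  by rewrite /circle_proj intrB; ring.
by have := floor_itv x; rewrite !intrD intrN; lra.
Qed.

Lemma circle_proj_id (x : R) : 0 <= x < 1 -> circle_proj x = x.
Proof. by move=> x01; rewrite (@circle_proj_eq x 0) ?subr0. Qed.

Lemma arc_length_le (J : set R) (c : R) : (mu J <= c%:E)%E -> arc_length J <= c.
Proof.
move=> Jc; rewrite /arc_length -lee_fin fineK // ge0_fin_numE //.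
by rewrite (le_lt_trans Jc) // ltry.
Qed.

Lemma arc_sub_circle (J : set R) : is_arc J -> J `<=` `[0, 1[.
Proof.
by move=> [I ->] _ [u _ <-] /=; rewrite in_itv /= circle_proj_itv.
Qed.

Lemma arc_length_le1 (J : set R) : is_arc J -> arc_length J <= 1.
Proof.
move=> /arc_sub_circle J01; apply: arc_length_le.
apply: le_trans (lebesgue_le J01) _.
by rewrite /= lebesgue_measure_itv /= lte_fin ltr01 oppr0 adde0.
Qed.

Lemma is_arc_set0 : is_arc (set0 : set R).
Proof.
exists `]0, 0[; apply/seteqP; split => // x [u /=].
by rewrite in_itv /= => /andP[/lt_trans h /h]; rewrite ltxx.
Qed.

(** Projecting an interval to the circle cannot increase its measure.  If the
    interval crosses an integer, its image is covered by two pieces, one at each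
    end of [0, 1), whose lengths add up to d. *)
Lemma arc_length_diam (I : interval R) (d : R) : 0 <= d ->
  (forall u v, u \in I -> v \in I -> v - u <= d) ->
  arc_length (circle_proj @` [set` I]) <= d.
Proof.
move=> d0 diam; have [d1|d1] := leP 1 d.
  by rewrite (le_trans _ d1) // arc_length_le1 //; exists I.
have [[u0 u0I]|I0] := pselect (exists u, u \in I); last first.
  rewrite (_ : _ @` _ = set0); last first.
    by apply/seteqP; split => // y [u uI _]; case: I0; exists u.
  by apply: arc_length_le; rewrite measure0 lee_fin.
pose s := inf [set` I].
have lbI : has_lbound [set` I].
  by exists (u0 - d) => v vI; have := diam _ _ vI u0I; lra.
have sI u : u \in I -> s <= u by move=> uI; apply: ge_inf.
have Is u : u \in I -> u <= s + d.
  move=> uI; rewrite -lerBlDr; apply: lb_le_inf; first by exists u0.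
  by move=> v vI; have := diam _ _ vI uI; lra.
(* Translate so that the interval starts at r in [0, 1). *)
pose k := Num.floor s; pose r := s - k%:~R.
have /andP[r0 r1] : 0 <= r < 1 by apply: circle_proj_itv.
apply: arc_length_le.
have proj u : u \in I -> circle_proj u = u - k%:~R \/
    (1 <= u - k%:~R /\ circle_proj u = u - k%:~R - 1).
  move=> uI; have := sI _ uI; have := Is _ uI; rewrite /r in r0 r1 => h1 h2.
  have [lt1|ge1] := ltP (u - k%:~R) 1.
    by left; apply: circle_proj_eq; rewrite intrD; lra.
  right; split => //; rewrite (@circle_proj_eq u (k + 1)) intrD ?intrD; lra.
have [rd|rd] := ltP (r + d) 1.
  have sub : circle_proj @` [set` I] `<=` `[r, r + d].
    move=> _ [u /= uI <-]; rewrite in_itv /=.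
    have := sI _ uI; have := Is _ uI; rewrite /r in rd *.
    by case: (proj _ uI) => [->|[h ->]]; lra.
  apply: le_trans (lebesgue_le sub) _.
  rewrite /= lebesgue_measure_itv /= lte_fin.
  by case: ifP => _; rewrite ?lee_fin //; lra.
have sub : circle_proj @` [set` I] `<=` `[r, 1] `|` `[0, r + d - 1].
  move=> _ [u /= uI <-]; rewrite !in_itv /=.
  have := sI _ uI; have := Is _ uI; rewrite /r in rd r0 r1 *.
  have := circle_proj_itv u.
  by case: (proj _ uI) => [->|[h ->]]; [left|right]; lra.
apply: le_trans (lebesgue_le sub) _.
apply: le_trans (lebesgue_setU_le _ _) _.
rewrite /= !lebesgue_measure_itv /= !lte_fin r1.
by case: ifP => _; rewrite -?EFinD ?adde0 lee_fin; lra.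
Qed.

Variable (a : nat -> nat).

Lemma max_gap_ge (N : nat) (x : R) (J : set R) :
  is_arc J -> J `&` dilates a N x = set0 -> arc_length J <= max_gap a N x.
Proof.
move=> Ja J0; apply: ub_le_sup; last by exists J.
by exists 1 => _ [K [Ka _] <-]; exact: arc_length_le1.
Qed.

Lemma max_gap_le (N : nat) (x c : R) :
  (forall J, is_arc J -> J `&` dilates a N x = set0 -> arc_length J <= c) ->
  max_gap a N x <= c.
Proof.
move=> H; apply: ge_sup => [|_ [J [Ja J0] <-]]; last exact: H.
exists (arc_length (set0 : set R)), set0 => //.
by split; [exact: is_arc_set0 | rewrite set0I].
Qed.

Lemma max_gap_mono (N N' : nat) (x : R) : (N <= N')%N ->
  max_gap a N' x <= max_gap a N x.
Proof.
move=> NN; apply: max_gap_le => J Ja J0; apply: max_gap_ge => //.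
rewrite -subset0 -J0 => y [Jy [n /= nN ny]]; split=> //.
exists n => //=; lia.
Qed.

Section Discrete.
Variables (N M Q : nat) (b : nat -> nat).
Hypothesis M0 : (0 < M)%N.
Hypothesis b0 : forall n, (1 <= n <= N)%N -> (0 < b n)%N.
Hypothesis QE : forall n, (1 <= n <= N)%N -> Q = (a n * (M * b n))%N.
Variable x : R.
Hypothesis x01 : 0 <= x < 1.
Let j := Num.truncn (Q%:R * x).

(** Exactness of the discretisation: Q x = b n * (M * (a n) x), so the integer part
    of M * (a n) x depends on x only through the integer part j of Q x. *)
Lemma quotient_spec n : (1 <= n <= N)%N ->
  (j %/ b n)%N%:R / M%:R <= (a n)%:R * x < ((j %/ b n)%N%:R + 1) / M%:R.
Proof.
move=> nN; have bn0 := b0 nN; set D := (j %/ b n)%N.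
have Mr : 0 < M%:R :> R by rewrite ltr0n.
have br : 0 < (b n)%:R :> R by rewrite ltr0n.
have Qx : 0 <= Q%:R * x by case/andP: x01 => h _; rewrite mulr_ge0.
have /andP[j1 j2] := truncn_itv Qx; rewrite -/j in j1 j2.
have E : Q%:R * x = (b n)%:R * (M%:R * ((a n)%:R * x)).
  by rewrite (QE nN) !natrM; ring.
have D1 : (b n)%:R * D%:R <= Q%:R * x.
  by rewrite (le_trans _ j1) // -natrM ler_nat mulnC leq_divM.
have D2 : Q%:R * x < (b n)%:R * (D%:R + 1).
  rewrite (lt_le_trans j2) // natr1 -natrM ler_nat mulnC; exact: ltn_ceil.
rewrite ler_pdivrMr // ltr_pdivlMr // ![_ * x * _]mulrC.
by move: D1 D2; rewrite E ler_pM2l // ltr_pM2l // => -> ->.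
Qed.

Lemma digit_spec n : (1 <= n <= N)%N ->
  (digit b M n j)%:R / M%:R <= circle_proj ((a n)%:R * x)
    < ((digit b M n j)%:R + 1) / M%:R.
Proof.
move=> nN; have := quotient_spec nN; rewrite /digit.
set D := (j %/ b n)%N; have Dm := ltn_pmod D M0.
have Mr : 0 < M%:R :> R by rewrite ltr0n.
have DE : D%:R / M%:R = (D %/ M)%N%:R + (D %% M)%N%:R / M%:R :> R.
  rewrite {1}(divn_eq D M) natrD natrM mulrDl mulfK ?gt_eqF //.
rewrite mulrDl DE mulrDl => /andP[h1 h2].
have d1 : (D %% M)%N%:R / M%:R + 1 / M%:R <= 1 :> R.
  by rewrite -mulrDl ler_pdivrMr // mul1r natr1 ler_nat.
have d0 : 0 <= (D %% M)%N%:R / M%:R :> R by rewrite divr_ge0.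
rewrite (@circle_proj_eq _ (D %/ M)%N) ?intrD -?pmulrn; lra.
Qed.

Lemma gap_of_fresh : nfresh b M N j != 0%N -> M%:R^-1 <= max_gap a N x.
Proof.
have Mr : 0 < M%:R :> R by rewrite ltr0n.
move=> nf; have [v vM fv] : exists2 v, (v < M)%N & fresh b M N j v.
  apply: contra_neqP nf => H; rewrite /nfresh big_nat_cond big1 // => v.
  rewrite andbT => /andP[_ vM]; case E : fresh => //; case: H; by exists v.
pose I : interval R := `[v%:R / M%:R, (v%:R + 1) / M%:R[.
have I01 u : u \in I -> 0 <= u < 1.
  rewrite in_itv /= => /andP[h1 h2]; rewrite (le_trans _ h1) ?divr_ge0 //=.
  by rewrite (lt_le_trans h2) // ler_pdivrMr // mul1r natr1 ler_nat.
have JI : circle_proj @` [set` I] = [set` I].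
  apply/seteqP; split => [_ [u /= uI <-]|u /= uI]; first by rewrite circle_proj_id ?I01.
  by exists u => //=; rewrite circle_proj_id ?I01.
have <- : arc_length (circle_proj @` [set` I]) = M%:R^-1.
  rewrite JI /arc_length lebesgue_measure_itv /= lte_fin ltr_pM2r ?invr_gt0 //.
  by rewrite ltrDl ltr01 -EFinD /= -mulrBl addrAC subrr add0r mul1r.
apply: max_gap_ge; first by exists I.
rewrite JI -subset0 => y [/= yI [n /= nN nE]]; subst y.
have nN' : (1 <= n <= N)%N by [].
move/allP: fv => /(_ n); rewrite mem_iota => /(_ _)/negP; apply; first by lia.
have /andP[d1 d2] := digit_spec nN'; move: yI; rewrite in_itv /= => /andP[y1 y2].
set v' := digit b M n j in d1 d2 *.
have : v%:R / M%:R < (v'%:R + 1) / M%:R :> R by apply: le_lt_trans d2.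
have : v'%:R / M%:R < (v%:R + 1) / M%:R :> R by apply: le_lt_trans y2.
rewrite !ltr_pM2r ?invr_gt0 // !natr1 !ltr_nat => h1 h2.
by apply/eqP; lia.
Qed.

(** An interval longer than (t + 1) / M contains t consecutive cells of the grid
    of mesh 1 / M, hence a point of the orbit. *)
Lemma gap_of_hits (t : nat) : (t <= M)%N ->
  (forall i, (i < M)%N -> exists2 n, (1 <= n <= N)%N & arc_hit b M t i n j) ->
  max_gap a N x <= (t%:R + 1) / M%:R.
Proof.
move=> tM hits; have Mr : 0 < M%:R :> R by rewrite ltr0n.
apply: max_gap_le => J [I ->] J0; apply: arc_length_diam; first by rewrite divr_ge0 // addr_ge0.
move=> u v uI vI; rewrite leNgt; apply/negP => uv.
pose i0 : int := Num.ceil (u * M%:R).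
have /andP[c1 c2] := ceil_itv (u * M%:R); rewrite -/i0 intrB in c1 c2.
pose i := `|(i0 %% M)%Z|%N.
have Mz : (M%:Z != 0) by rewrite -lt0n.
have iE : (i%:Z = i0 %% M)%Z by rewrite gez0_abs // modz_ge0.
have iM : (i < M)%N by rewrite -ltz_nat iE ltz_pmod.
have [n nN hit] := hits i iM.
rewrite arc_hitE ?b0 // in hit.
set D := (j %/ b n)%N in hit; set s := ((D + (M - i)) %% M)%N in hit.
(* The integer by which (a n) x must be translated to fall into the chosen run
   of cells inside the interval. *)
pose z : int := ((D + (M - i)) %/ M)%N%:Z - 1 - (i0 %/ M)%Z.
have DE : (D%:Z = i0 + s%:Z + M%:Z * z)%Z.
  have h1 := divn_eq (D + (M - i)) M; rewrite -/s in h1.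
  have h2 := divz_eq i0 M; rewrite -iE in h2.
  rewrite /z; set e1 := ((D + (M - i)) %/ M)%N in h1 *; set e2 := (i0 %/ M)%Z in h2 *.
  have h3 : (D%:Z + (M%:Z - i%:Z) = e1%:Z * M%:Z + s%:Z)%Z by clear - h1 iM; lia.
  by rewrite h2; clear - h3; lia.
have /andP[d1 d2] := quotient_spec nN; rewrite -/D in d1 d2.
have Dr : D%:R = i0%:~R + s%:R + M%:R * z%:~R :> R.
  have nz (m : nat) : m%:R = (m%:Z)%:~R :> R by [].
  by clearbody z; rewrite (nz D) DE !intrD intrM.
pose y := (a n)%:R * x - z%:~R.
have y1 : u <= y.
  rewrite -(ler_pM2r Mr) mulrBl (le_trans c2) //.
  move: d1; rewrite ler_pdivrMr // Dr; have : 0 <= s%:R :> R by []; lra.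
have y2 : y <= v.
  rewrite -(ler_pM2r Mr) mulrBl.
  move: uv; rewrite ltr_pdivrMr //; move: d2; rewrite ltr_pdivlMr // Dr.
  have : s%:R + 1 <= t%:R :> R by rewrite natr1 ler_nat.
  rewrite mulrBl; lra.
have yI : y \in I.
  have := @interval_is_interval _ I; move=> /(_ u v uI vI); apply.
  by rewrite y1 y2.
have : (circle_proj @` [set` I] `&` dilates a N x) (circle_proj ((a n)%:R * x)).
  split; last by exists n.
  by exists y => //; rewrite /y circle_proj_subz.
by rewrite J0.
Qed.

End Discrete.
End CircleGeometry.

(** * From counting to Lebesgue measure *)

Section Covers.
Variable R : realType.
Notation mu := (@lebesgue_measure R).

(** An upper bound for the measure of a set which need not be measurable. *)
Definition covered (E : set R) (c : R) : Prop :=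
  exists C : set (measurableTypeR R), [/\ measurable C, E `<=` C & (mu C <= c%:E)%E].

Lemma covered_cells (Q : nat) (S : nat -> bool) : (0 < Q)%N ->
  covered [set x | 0 <= x < 1 /\ S (Num.truncn (Q%:R * x))]
    (Q%:R^-1 * \sum_(0 <= j < Q) (S j)%:R).
Proof.
move=> Q0; have Qr : 0 < Q%:R :> R by rewrite ltr0n.
pose cell j : set R := `[j%:R / Q%:R, j.+1%:R / Q%:R[%classic.
have [C [mC sC cC]] : exists C, [/\ measurable C,
    (forall j, (j < Q)%N -> S j -> cell j `<=` C) &
    (mu C <= (Q%:R^-1 * \sum_(0 <= j < Q) (S j)%:R)%:E)%E].
  elim: {1 3}Q => [|k [C [mC sC cC]]].
    by exists set0; split => //; rewrite measure0 big_geq // mulr0.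
  exists (C `|` (if S k then cell k else set0)); split.
  - by apply: measurableU => //; case: (S k) => //; exact: measurable_itv.
  - move=> j; rewrite ltnS leq_eqVlt => /orP[/eqP ->|jk] Sj; last first.
      by apply: subset_trans (sC _ jk Sj) _; left.
    by rewrite Sj; right.
  apply: le_trans (lebesgue_setU_le _ _) _.
  rewrite big_nat_recr //= mulrDr EFinD leeD //.
  case: (S k); last by rewrite measure0 mulr0.
  rewrite mulr1 lebesgue_measure_itv /= lte_fin; case: ifP => _; last first.
    by rewrite lee_fin invr_ge0.
  by rewrite -EFinD lee_fin -mulrBl -natrB // subSnn mul1r.
exists C; split => // x [/andP[x0 x1] Sx].
have Qx : 0 <= Q%:R * x by rewrite mulr_ge0.
have /andP[j1 j2] := truncn_itv Qx.
have jQ : (Num.truncn (Q%:R * x) < Q)%N.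
  by rewrite -(ltr_nat R) (le_lt_trans j1) // -[ltRHS]mulr1 ltr_pM2l.
apply: (sC _ jQ Sx); rewrite /cell /= in_itv /=.
by rewrite ler_pdivrMr // ltr_pdivlMr // [x * _]mulrC j1 j2.
Qed.

Lemma covered_sub (E F : set R) (c d : R) : E `<=` F -> c <= d -> covered F c -> covered E d.
Proof.
move=> EF cd [C [mC FC cC]]; exists C; split => //; first exact: subset_trans FC.
by rewrite (le_trans cC) // lee_fin.
Qed.

(** The first Borel-Cantelli lemma, for sets given with measurable covers. *)
Lemma ae_eventually (E : nat -> set R) (p : nat -> R) (B : R) (K0 : nat) :
  (forall k, (K0 <= k)%N -> covered (E k) (p k)) ->
  (forall k, 0 <= p k) -> (forall n, \sum_(0 <= k < n) p k <= B) ->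
  {ae mu, forall x, exists K, forall k, (K <= k)%N -> ~ E k x}.
Proof.
move=> cov p0 pB.
have /choice[C HC] : forall k, exists C,
    [/\ measurable C, ((K0 <= k)%N -> E k `<=` C) & (mu C <= (p k)%:E)%E].
  move=> k; have [Kk|Kk] := leqP K0 k.
    by have [C [mC EC pC]] := cov k Kk; exists C.
  by exists set0; split => //; rewrite measure0 lee_fin.
have mC k : measurable (C k) by have [] := HC k.
have C0 : mu (lim_sup_set C) = 0%E.
  apply: lim_sup_set_cvg0 => //; apply: (@le_lt_trans _ _ B%:E); last exact: ltry.
  apply: lime_le; first by apply: is_cvg_nneseries.
  apply: nearW => n; apply: le_trans (_ : ((\sum_(0 <= k < n) p k)%:E <= _)%E); last by rewrite lee_fin.
  by rewrite -sumEFin; apply: lee_sum => k _; have [] := HC k.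
exists (lim_sup_set C); split => //.
  by apply: bigcapT_measurable => n; apply: bigcup_measurable => k _; exact: mC.
move=> x /= nx n _ /=; apply: contrapT => nC; apply: nx.
exists (maxn n K0) => k; rewrite geq_max => /andP[nk Kk] Ek; apply: nC.
by exists k => //; have [_ /(_ Kk) sE _] := HC k; apply: sE.
Qed.

End Covers.

Section LacunaryModel.
Variables (R : realType) (a : nat -> nat) (q : R).
Hypothesis q1 : 1 < q.
Hypothesis a0 : forall n, (1 <= n)%N -> (0 < a n)%N.
Hypothesis alac : forall n, (1 <= n)%N -> q * (a n)%:R <= (a n.+1)%:R.

Lemma lacunary_growth g m : (1 <= m)%N -> q ^+ g * (a m)%:R <= (a (m + g)%N)%:R.
Proof.
move=> m1; elim: g => [|g IH]; first by rewrite expr0 mul1r addn0.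
rewrite exprS -mulrA addnS (le_trans _ (alac _)) //; last by lia.
by rewrite ler_wpM2l //; have := q1; lra.
Qed.

Lemma lacunary_mono m n : (1 <= m)%N -> (m <= n)%N -> (a m <= a n)%N.
Proof.
move=> m1 mn; rewrite -(ler_nat R) -(subnKC mn).
apply: le_trans (lacunary_growth (n - m) m1).
by rewrite ler_peMl // exprn_ege1 // ltW.
Qed.

Variables (N M w : nat).
Hypothesis M0 : (0 < M)%N.
Hypothesis w0 : (0 < w)%N.

(** The number of equally likely values of the discretised x. *)
Definition resolution : nat := (M * w * \prod_(1 <= m < N.+1) a m)%N.
(** The quotient of the resolution by M * a n, written as a product so that it is
    visibly a multiple of w. *)
Definition width (n : nat) : nat := (w * \prod_(1 <= m < N.+1 | m != n) a m)%N.

Lemma width_gt0 n : (0 < width n)%N.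
Proof.
rewrite muln_gt0 w0 /= big_seq_cond prodn_cond_gt0 // => m.
by rewrite mem_index_iota => /andP[/andP[m1 _] _]; exact: a0.
Qed.

Lemma resolutionE n : (1 <= n <= N)%N -> resolution = (a n * (M * width n))%N.
Proof.
move=> nN; rewrite /resolution /width (bigD1_seq n) ?iota_uniq ?mem_index_iota ?ltnS //=.
lia.
Qed.

Lemma dvdn_width n : (w %| width n)%N.
Proof. exact: dvdn_mulr. Qed.

Lemma resolution_gt0 : (0 < resolution)%N.
Proof.
rewrite !muln_gt0 M0 w0 /= big_seq_cond prodn_cond_gt0 // => m.
by rewrite mem_index_iota => /andP[/andP[m1 _] _]; exact: a0.
Qed.

Variables (g : nat) (eta : R).
Hypothesis meshG : (M * w)%:R <= eta * q ^+ g.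

Let G0 : 0 < q ^+ g. Proof. by rewrite exprn_gt0 //; have := q1; lra. Qed.

(** Union bound over the M arcs of t consecutive cells. *)
Lemma large_gap_covered (t L k : nat) (gam : R) :
  (t <= M)%N -> (0 < L)%N -> (0 < g)%N -> eta <= 1 / 4 -> 0 <= gam ->
  (forall p, (1 <= p)%N ->
    \sum_(p <= m < p + L) \sum_(m.+1 <= n < p + L) (a m)%:R / (a n)%:R <= L%:R * gam) ->
  (k.+1 * (L + g) <= N)%N ->
  let del := t%:R / M%:R in
  let rate := L%:R * del / (1 + 2 * gam + L%:R * del) * (1 - 4 * eta) in
  covered [set x | 0 <= x < 1 /\ (t%:R + 1) / M%:R < max_gap a N x]
    (M%:R * ((1 - rate) ^+ k + k%:R * (N%:R / w%:R))).
Proof.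
move=> tM L0 g0 eta4 gam0 Hgam kN del rate.
pose Q := resolution; pose b := width.
pose miss i j := all (fun n => ~~ arc_hit b M t i n j) (index_iota 1 N.+1).
pose S j := has (fun i => miss i j) (iota 0 M).
have Q0 : 0 < Q%:R :> R by rewrite ltr0n resolution_gt0.
apply: (covered_sub (F := [set x | 0 <= x < 1 /\ S (Num.truncn (Q%:R * x))])
   (c := Q%:R^-1 * \sum_(0 <= j < Q) (S j)%:R)); last 1 first.
- exact: covered_cells resolution_gt0.
- move=> x [x01 gap]; split => //; apply: contraLR gap => /hasPn nS; rewrite -leNgt.
  apply: (gap_of_hits (b := b) (Q := Q)) => //.
  + by move=> n _; exact: width_gt0.
  + exact: resolutionE.
  move=> i iM; have := nS i; rewrite mem_iota add0n => /(_ iM) /allPn[n].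
  by rewrite mem_index_iota ltnS negbK => nN hit; exists n.
rewrite ler_pdivrMl //.
apply: (@le_trans _ _ (\sum_(0 <= j < Q) \sum_(0 <= i < M) (miss i j)%:R)).
  apply: ler_sum => j _; rewrite /S.
  case: hasP => [[i iM mi]|_]; last by rewrite sumr_ge0.
  rewrite (bigD1_seq i) ?iota_uniq //=; last by rewrite /index_iota subn0.
  by rewrite mi lerDl sumr_ge0.
rewrite exchange_big /= mulrCA.
have -> E : M%:R * E = \sum_(0 <= j < M) E :> R by rewrite sumr_const_nat subn0 mulr_natl.
apply: ler_sum => i _.
apply: (missed_arc_count M0 w0 (fun n _ => width_gt0 n) (fun n nN => a0 (proj1 (andP nN)))
  resolutionE (fun n _ => dvdn_width n) (fun m n m1 mn _ => lacunary_mono m1 mn)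
  i tM L0 g0 (fun m m1 _ => lacunary_growth g m1)) => //.
Qed.

Lemma small_gap_covered (th : R) :
  (1 < M)%N -> (0 < g)%N -> (g <= N)%N -> (g <= M)%N -> eta <= 1 / 2 -> 0 <= th ->
  th * g%:R <= 1 / 4 ->
  covered [set x | 0 <= x < 1 /\ max_gap a N x < M%:R^-1]
    (expR (2 * th / M%:R * g.-1%:R * N%:R) *
    (expR (- (th * (1 - 2 / M%:R) ^+ N * (M%:R - g%:R))) + N%:R * (N%:R / w%:R))).
Proof.
move=> M1 g0 gN gM eta2 th0 thg.
pose Q := resolution; pose b := width.
have Q0 : 0 < Q%:R :> R by rewrite ltr0n resolution_gt0.
apply: (covered_sub (F := [set x | 0 <= x < 1 /\ nfresh b M N (Num.truncn (Q%:R * x)) == 0%N])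
   (c := Q%:R^-1 * \sum_(0 <= j < Q) (nfresh b M N j == 0%N)%:R)); last 1 first.
- exact: covered_cells resolution_gt0.
- move=> x [x01 gap]; split => //; apply: contraLR gap => nS; rewrite -leNgt.
  apply: (gap_of_fresh (b := b) (Q := Q)) => //.
  + by move=> n _; exact: width_gt0.
  + exact: resolutionE.
rewrite ler_pdivrMl //; have E : g = g.-1.+1 by lia.
rewrite {2}E.
have meshG' : (M * w)%:R <= eta * q ^+ g.-1.+1 by rewrite -E; exact: meshG.
have G0' : 0 < q ^+ g.-1.+1 by rewrite -E; exact: G0.
apply: (all_hit_count M0 w0 (fun n _ => width_gt0 n) (fun n nN => a0 (proj1 (andP nN)))
  resolutionE (fun n _ => dvdn_width n) (fun m n m1 mn _ => lacunary_mono m1 mn)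
  (fun m m1 _ => lacunary_growth g.-1.+1 m1) G0' meshG' eta2) => //; rewrite -?E //.
Qed.

End LacunaryModel.

(** * The constant Gamma, and comparison of growth *)

Section LimSup.
Variable R : realType.
Implicit Types u : nat -> \bar R.

Lemma limn_esup_le u (c : \bar R) (N0 : nat) :
  (forall N, (N0 <= N)%N -> (u N <= c)%E) -> (limn_esup u <= c)%E.
Proof.
move=> H; apply: (@le_trans _ _ (ereal_sup [set u N | N in [set N | (N0 <= N)%N]])).
  apply: ereal_inf_lbound; exists [set N | (N0 <= N)%N] => //.
  by exists N0.
by apply: ge_ereal_sup => _ [N /= N0N <-]; exact: H.
Qed.

Lemma limn_esup_lt u (c : \bar R) : (limn_esup u < c)%E ->
  exists N0, forall N, (N0 <= N)%N -> (u N <= c)%E.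
Proof.
move=> /ereal_inf_lt[_ [V [N0 _ N0V] <-] supc].
exists N0 => N N0N; apply: le_trans (ltW supc); apply: ereal_sup_ubound.
by exists N => //; exact: N0V.
Qed.

Lemma limn_esup_ge u (c : \bar R) : (forall N, c <= u N)%E -> (c <= limn_esup u)%E.
Proof.
move=> H; apply: le_ereal_inf_tmp => _ [V [N0 _ N0V] <-].
by apply: le_trans (H N0) _; apply: ereal_sup_ubound; exists N0 => //; apply: N0V => /=.
Qed.

Lemma limn_einf_ge u (c : \bar R) (N0 : nat) :
  (forall N, (N0 <= N)%N -> (c <= u N)%E) -> (c <= limn_einf u)%E.
Proof.
by move=> H; rewrite /limn_einf leeNr; apply: (limn_esup_le (N0 := N0)) => N /H; rewrite leeN2.
Qed.

End LimSup.

Section Correlations.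
Variables (R : realType) (a : nat -> nat) (q : R).
Hypothesis q1 : 1 < q.
Hypothesis a0 : forall n, (1 <= n)%N -> (0 < a n)%N.
Hypothesis alac : forall n, (1 <= n)%N -> q * (a n)%:R <= (a n.+1)%:R.

(** Since a n.+1 >= q * a n, one has (q - 1) / a n.+1 <= 1 / a n - 1 / a n.+1, and
    the right-hand side telescopes. *)
Lemma sum_ratio_le m k : (1 <= m)%N ->
  \sum_(m.+1 <= n < m.+1 + k) (a m)%:R / (a n)%:R <=
  (1 - (a m)%:R / (a (m + k)%N)%:R) / (q - 1) :> R.
Proof.
move=> m1; have q1' := q1.
have am0 : 0 < (a m)%:R :> R by rewrite ltr0n a0.
elim: k => [|k IH]; first by rewrite addn0 big_geq // addn0 divff ?subrr ?mul0r // gt_eqF.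
rewrite addnS big_nat_recr /=; last by rewrite leq_addr.
apply: le_trans (lerD IH (lexx _)) _.
rewrite ler_pdivlMr ?subr_gt0 // mulrDl divfK; last by rewrite gt_eqF // subr_gt0.
rewrite addSn addnS.
have mk0 : 0 < (a (m + k)%N)%:R :> R by rewrite ltr0n a0 //; lia.
have mk1 : 0 < (a (m + k).+1)%:R :> R by rewrite ltr0n a0.
have lac : q * (a (m + k)%N)%:R <= (a (m + k).+1)%:R by apply: alac; lia.
have : q / (a (m + k).+1)%:R <= 1 / (a (m + k)%N)%:R.
  by rewrite ler_pdivrMr // mulrAC mul1r ler_pdivlMr.
move/(ler_wpM2l (ltW am0)); rewrite mulrA mul1r.
set x := _ / (a (m + k)%N)%:R; have -> : (a m)%:R * q / (a (m + k).+1)%:R =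
  q * ((a m)%:R / (a (m + k).+1)%:R) by ring.
set y := _ / (a (m + k).+1)%:R; lra.
Qed.

Lemma Gamma_avg_le p L : (1 <= p)%N -> Gamma_avg a p L <= (q - 1)^-1 :> R.
Proof.
move=> p1; have q1' := q1; have q0 : 0 < q - 1 by lra.
rewrite /Gamma_avg; have [->|L0] := posnP L.
  by rewrite invr0 mul0r invr_ge0 ltW.
rewrite ler_pdivrMl ?ltr0n //.
apply: (@le_trans _ _ (\sum_(p <= m < p + L) (q - 1)^-1)); last first.
  by rewrite sumr_const_nat addKn mulr_natl.
rewrite big_nat_cond [leRHS]big_nat_cond; apply: ler_sum => m; rewrite andbT => mB.
have m1 : (1 <= m)%N by lia.
have := sum_ratio_le (p + L - m) m1; rewrite addSn subnKC; last by lia.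
move/le_trans; apply; by rewrite ler_pdivrMr // mulVf ?gt_eqF // lerBlDr lerDl divr_ge0.
Qed.

Lemma Gamma_avg_ge0 p L : 0 <= Gamma_avg a p L :> R.
Proof.
rewrite /Gamma_avg mulr_ge0 ?invr_ge0 //; apply: sumr_ge0 => m _.
by apply: sumr_ge0 => n _; rewrite divr_ge0.
Qed.

Lemma Gamma_bounds : (0 <= Gamma a :> \bar R)%E /\ (Gamma a <= ((q - 1)^-1)%:E)%E.
Proof.
split.
  apply: limn_esup_ge => L; apply: le_trans (_ : ((Gamma_avg a 1 L)%:E <= _)%E).
    by rewrite lee_fin Gamma_avg_ge0.
  by apply: ereal_sup_ubound; exists 1%N.
apply: (limn_esup_le (N0 := 0%N)) => L _.
by apply: ge_ereal_sup => _ [p /= p1 <-]; rewrite lee_fin Gamma_avg_le.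
Qed.

Lemma Gamma_fine : Gamma a = (fine (Gamma a : \bar R))%:E.
Proof.
have [h1 h2] := Gamma_bounds; rewrite fineK // ge0_fin_numE //.
by rewrite (le_lt_trans h2) // ltry.
Qed.

Lemma correlations_le (gam : R) : fine (Gamma a : \bar R) < gam ->
  exists L0, forall L p, (L0 <= L)%N -> (1 <= p)%N ->
    \sum_(p <= m < p + L) \sum_(m.+1 <= n < p + L) (a m)%:R / (a n)%:R <= L%:R * gam.
Proof.
move=> Ggam; have : (Gamma a < gam%:E :> \bar R)%E by rewrite Gamma_fine lte_fin.
move=> /limn_esup_lt[L0 HL]; exists L0 => L p L0L p1.
have [->|Lpos] := posnP L; first by rewrite addn0 big_geq // mul0r.
have : Gamma_avg a p L <= gam.
  rewrite -lee_fin; apply: le_trans (HL _ L0L); apply: ereal_sup_ubound.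
  by exists p.
rewrite /Gamma_avg ler_pdivrMl ?ltr0n //; apply: le_trans.
apply: ler_sum_nat => m mB; rewrite [leRHS]big_nat_recr /=; last by lia.
by rewrite lerDl divr_ge0.
Qed.

End Correlations.

Section Growth.
Variable R : realType.

Lemma ln_nat_near (B : R) : \forall N \near \oo, B <= ln N%:R.
Proof.
near=> N.
have N1 : (Num.truncn (expR B)).+1%:R <= N%:R :> R.
  by rewrite ler_nat; near: N; exact: nbhs_infty_ge.
have /andP[_ t2] := truncn_itv (expR_ge0 B).
have N0 : 0 < N%:R :> R by apply: lt_le_trans N1; rewrite ltr0n.
rewrite -[B]expRK ler_ln ?posrE ?expR_gt0 //.
exact: le_trans (ltW t2) N1.
Unshelve. all: by end_near. Qed.

Lemma poly_le_expR (eps C : R) (k : nat) : 0 < eps ->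
  \forall N \near \oo, C * ln (N%:R : R) ^+ k <= expR (eps * ln N%:R).
Proof.
move=> e0; pose D := eps ^+ k.+1 / (k.+1)`!%:R.
have D0 : 0 < D by rewrite divr_gt0 ?exprn_gt0 // ltr0n fact_gt0.
near=> N.
have l0 : 0 <= ln N%:R :> R by near: N; exact: ln_nat_near.
have lC : C / D <= ln N%:R :> R by near: N; exact: ln_nat_near.
have := expR_ge1Dxn k (mulr_ge0 (ltW e0) l0).
rewrite exprMn => h; apply: (@le_trans _ _ (D * ln N%:R ^+ k.+1)).
  rewrite exprS mulrA ler_wpM2r ?exprn_ge0 //.
  by move: lC; rewrite ler_pdivrMr // mulrC.
apply: le_trans h; rewrite /D mulrAC.
by rewrite lerDr.
Unshelve. all: by end_near. Qed.

Lemma poly_le_nat (C : R) (k : nat) :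
  \forall N \near \oo, C * ln (N%:R : R) ^+ k <= N%:R.
Proof.
near=> N; have N0 : (0 < N)%N by near: N; exact: nbhs_infty_ge.
have : C * ln (N%:R : R) ^+ k <= expR (1 * ln N%:R).
  by near: N; exact: poly_le_expR.
by rewrite mul1r lnK // posrE ltr0n.
Unshelve. all: by end_near. Qed.

Lemma natr_lnK (N : nat) : (0 < N)%N -> N%:R = expR (ln N%:R) :> R.
Proof. by move=> N0; rewrite lnK // posrE ltr0n. Qed.

End Growth.

(** * Choice of the scales: exceptional gaps are rare *)

(** The arithmetic of the upper bound: the expected number k * rate of successful
    blocks exceeds (1 + eta) log N.  Here n, l, g, L, k, M stand for N, log N, the
    lag, the block length, the number of blocks and the number of cells, and each
    of the approximations made (lags, rounding of M, t against t + 1, L * del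
    against 0) costs a relative error of order eta. *)
Lemma block_rate_ge (R : realFieldType) (gam lam eta n l g L k M t : R) :
  0 <= gam -> 1 <= lam -> 0 < eta -> eta < 1 / 16 ->
  16 * (lam * eta) = lam - (1 + 2 * gam) ->
  0 < n -> 1 <= l -> 0 < L -> L = g * g -> 1 <= eta * g -> 0 <= k -> 0 < t -> 0 < M ->
  2 <= eta * t -> lam * l <= n -> L * lam * l <= eta * n -> 2 * L <= eta * n ->
  n <= (k + 2) * (L + g) ->
  (t + 1) * n <= M * (lam * l) -> M * (lam * l) <= (t + 1) * n + lam * l ->
  (1 + eta) * l <=
  L * (t / M) / (1 + 2 * gam + L * (t / M)) * (1 - 4 * eta) * k.
Proof.
move=> gam0 lam1 eta0 eta1 etaE n0 l1 L0 LE eg k0 t0 M0 et ln Lln Ln kn M1 M2.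
set del := t / M; have del0 : 0 < del by rewrite divr_gt0.
have tE : t = del * M by rewrite /del divfK // gt_eqF.
have gL : g <= eta * L.
  by rewrite LE mulrA ler_peMl //; have : 0 < eta * g; [lra|rewrite pmulr_rgt0 // => /ltW].
have kL : (1 - 2 * eta) * n <= k * L.
  have h1 : n <= (k + 2) * L * (1 + eta).
    apply: le_trans kn _; rewrite -mulrA ler_wpM2l //; first by lra.
    by lra.
  have h2 : (1 - eta) * n <= (k + 2) * L.
    have e1 : 0 <= 1 - eta by lra.
    apply: le_trans (ler_wpM2l e1 h1) _.
    have kL0 : 0 <= (k + 2) * L by rewrite mulr_ge0 //; lra.
    have -> : (1 - eta) * ((k + 2) * L * (1 + eta)) = (k + 2) * L * (1 - eta ^+ 2) by ring.
    by rewrite ler_piMr // lerBlDr lerDl sqr_ge0.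
  by move: h2; rewrite !mulrDl; lra.
have nd : (1 - 2 * eta) * (lam * l) <= n * del.
  have h1 : (1 - 2 * eta) * (lam * l) * M <= n * t.
    have e1 : 0 <= 1 - 2 * eta by lra.
    rewrite -mulrA [_ * M]mulrC; apply: le_trans (ler_wpM2l e1 M2) _.
    apply: (@le_trans _ _ ((1 - 2 * eta) * ((t + 2) * n))).
      by rewrite ler_wpM2l //; lra.
    rewrite mulrA mulrC ler_wpM2l ?(ltW n0) //.
    by rewrite !mulrDr mulrBl !mul1r -mulrA; lra.
  by move: h1; rewrite {1}tE [n * (_ * _)]mulrA ler_pM2r.
have Ld : L * del <= eta.
  have h1 : L * t * (lam * l) <= eta * M * (lam * l).
    apply: (@le_trans _ _ (eta * ((t + 1) * n))).
      apply: (@le_trans _ _ (t * (eta * n))).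
        have -> : L * t * (lam * l) = t * (L * lam * l) by ring.
        by rewrite ler_wpM2l // ltW.
      have : 0 <= eta * n by rewrite mulr_ge0 // ltW.
      have -> : eta * ((t + 1) * n) = t * (eta * n) + eta * n by ring.
      by rewrite lerDl.
    by rewrite -mulrA ler_wpM2l // ltW.
  have ll : 0 < lam * l by rewrite mulr_gt0 //; lra.
  move: h1; rewrite ler_pM2r // {1}tE mulrA ler_pM2r //.
have Ldel0 : 0 < L * del by rewrite mulr_gt0.
have den0 : 0 < 1 + 2 * gam + L * del by lra.
have -> : L * del / (1 + 2 * gam + L * del) * (1 - 4 * eta) * k =
    k * L * del * (1 - 4 * eta) / (1 + 2 * gam + L * del).
  by field; rewrite gt_eqF.
rewrite ler_pdivlMr //.
have e2 : 0 <= 1 - 2 * eta by lra.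
have e4 : 0 <= 1 - 4 * eta by lra.
have l0 : 0 <= l by lra.
apply: (@le_trans _ _ ((1 - 2 * eta) * ((1 - 2 * eta) * (lam * l)) * (1 - 4 * eta))); last first.
  rewrite ler_wpM2r //.
  apply: (@le_trans _ _ ((1 - 2 * eta) * n * del)).
    by rewrite -mulrA ler_wpM2l.
  by rewrite ler_wpM2r // ltW.
apply: (@le_trans _ _ ((1 + eta) * l * (1 + 2 * gam + eta))).
  by rewrite ler_wpM2l ?lerD2l // mulr_ge0 //; lra.
have -> : (1 + eta) * l * (1 + 2 * gam + eta) = l * ((1 + eta) * (1 + 2 * gam + eta)) by ring.
have -> : (1 - 2 * eta) * ((1 - 2 * eta) * (lam * l)) * (1 - 4 * eta) =
  l * (lam * ((1 - 2 * eta) ^+ 2 * (1 - 4 * eta))) by ring.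
rewrite ler_wpM2l //.
apply: (@le_trans _ _ (lam * (1 - 8 * eta))).
  have h1 : eta * eta <= eta * lam by rewrite ler_wpM2l //; lra.
  have le0 : 0 < lam * eta by rewrite mulr_gt0 //; lra.
  have h2 : eta * (2 * gam) <= eta * lam by rewrite ler_wpM2l //; lra.
  have h3 : eta * 1 <= eta * lam by rewrite ler_wpM2l //; lra.
  rewrite !mulrDl !mulrDr !mul1r !mulr1; lra.
rewrite ler_wpM2l //; first by lra.
rewrite -subr_ge0.
have -> : (1 - 2 * eta) ^+ 2 * (1 - 4 * eta) - (1 - 8 * eta) = 4 * eta ^+ 2 * (5 - 4 * eta) by ring.
by rewrite mulr_ge0 ?mulr_ge0 ?sqr_ge0 //; lra.
Qed.

Lemma block_rate_le1 (R : realFieldType) (gam eta y : R) :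
  0 <= gam -> 0 <= y -> 0 <= eta -> eta <= 1 / 4 ->
  y / (1 + 2 * gam + y) * (1 - 4 * eta) <= 1.
Proof.
move=> gam0 y0 eta0 eta4.
have d0 : 0 < 1 + 2 * gam + y by lra.
by rewrite mulr_ile1 ?divr_ge0 ?ler_pdivrMr //; lra.
Qed.

Section Events.
Variables (R : realType) (a : nat -> nat) (q : R).
Hypothesis q1 : 1 < q.
Hypothesis a0 : forall n, (1 <= n)%N -> (0 < a n)%N.
Hypothesis alac : forall n, (1 <= n)%N -> q * (a n)%:R <= (a n.+1)%:R.

Let lagC : R := 9 / ln q + 1.
(** A lag of order log N for which q ^ lag >= N ^ 9 and lag >= log N.  The exponent
    leaves room for M <= N cells, w = N ^ 4, and a mesh much longer than the
    periods. *)
Definition lag (N : nat) : nat := (Num.truncn (lagC * ln (N%:R : R))).+1.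

Lemma lnq_gt0 : 0 < ln q.
Proof. by rewrite ln_gt0. Qed.

Lemma lagC_ge1 : 1 <= lagC.
Proof. by rewrite /lagC lerDr divr_ge0 // ltW // lnq_gt0. Qed.

Lemma lag_bounds (N : nat) : 0 <= ln (N%:R : R) ->
  (lagC * ln (N%:R : R) <= (lag N)%:R) && ((lag N)%:R <= lagC * ln (N%:R : R) + 1).
Proof.
move=> l0; have A1 := lagC_ge1.
have Al : 0 <= lagC * ln (N%:R : R) by rewrite mulr_ge0 //; lra.
have /andP[h1 h2] := truncn_itv Al.
by rewrite /lag (ltW h2) /= -natr1 lerD2r.
Qed.

Lemma lag_growth (N : nat) : (0 < N)%N -> N%:R ^+ 9 <= q ^+ lag N :> R.
Proof.
move=> N0; have lq := lnq_gt0.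
have l0 : 0 <= ln (N%:R : R) by rewrite ln_ge0 // ler1n.
have /andP[h1 _] := lag_bounds l0.
have q0 : q \is Num.pos by rewrite posrE (lt_trans _ q1).
rewrite -(lnK q0) (natr_lnK R N0) -!expRM_natl ler_expR.
have : 9 / ln q * ln N%:R <= (lag N)%:R.
  by move: h1; rewrite /lagC mulrDl mul1r; lra.
by move/(ler_wpM2r (ltW lq)); rewrite mulrAC divfK // gt_eqF.
Qed.

Lemma mesh_lag (eta : R) (N M : nat) : (0 < N)%N -> (M <= N)%N -> 1 <= eta * N%:R ->
  (M * N ^ 4)%:R <= eta * q ^+ lag N.
Proof.
move=> N0 MN eN; have e0 : 0 <= eta.
  have : 0 < eta * N%:R by apply: lt_le_trans eN.
  by rewrite pmulr_lgt0 ?ltr0n // => /ltW.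
apply: (@le_trans _ _ (eta * N%:R ^+ 9)); last by rewrite ler_wpM2l // lag_growth.
apply: (@le_trans _ _ (N%:R * N%:R ^+ 4)).
  by rewrite natrM natrX ler_wpM2r ?exprn_ge0 // ler_nat.
have -> : eta * N%:R ^+ 9 = eta * N%:R * N%:R ^+ 3 * (N%:R * N%:R ^+ 4) by ring.
rewrite ler_peMl ?mulr_ge0 ?exprn_ge0 //.
by rewrite mulr_ege1 // exprn_ege1 // ler1n.
Qed.

(** Scales: blocks of length L = g^2 separated by lags g, both negligible against
    N, and arcs of t cells out of M with t / M about lam * log N / N.  A gap
    longer than (t + 1) / M contains such an arc, which costs a factor (t + 1) / t and
    forces t to be large. *)
Lemma large_gap_rare (gam lam : R) (L0 : nat) :
  0 <= gam -> 1 + 2 * gam < lam ->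
  (forall L p, (L0 <= L)%N -> (1 <= p)%N ->
    \sum_(p <= m < p + L) \sum_(m.+1 <= n < p + L) (a m)%:R / (a n)%:R <= L%:R * gam) ->
  exists2 eta : R, 0 < eta &
  \forall N \near \oo, covered
    [set x | 0 <= x < 1 /\ lam * ln N%:R / N%:R < max_gap a N x]
    (2 * expR (- (eta * ln N%:R))).
Proof.
move=> gam0 gl HL; pose kap := 1 + 2 * gam.
have lam0 : 1 < lam by rewrite /kap in gl; lra.
(* The errors of relative size eta add up to less than 16 eta. *)
pose eta := (lam - kap) / (16 * lam).
have eta0 : 0 < eta by rewrite divr_gt0 //; rewrite /kap; lra.
have etaE : 16 * (lam * eta) = lam - kap by rewrite /eta; field; lra.
have eta1 : eta < 1 / 16 by rewrite ltr_pdivrMr; rewrite /kap; lra.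
exists eta => //.
have [eta4 eta_le1] : eta <= 1 / 4 /\ eta <= 1 by split; lra.
have A1 := lagC_ge1.
(* Large enough for t / (t + 2) >= 1 - eta. *)
pose t := (Num.truncn (2 / eta)).+1.
have te : 2 <= eta * t%:R.
  have /andP[_ h] := truncn_itv (divr_ge0 (ler0n R 2) (ltW eta0)).
  by move: (ltW h); rewrite ler_pdivrMr // mulrC.
have t0 : 0 < t%:R :> R by rewrite ltr0n.
near=> N.
have N0 : (0 < N)%N by near: N; exact: nbhs_infty_ge.
have tl' : t%:R + 2 <= ln (N%:R : R) by near: N; exact: ln_nat_near.
have el : eta^-1 <= ln (N%:R : R) by near: N; exact: ln_nat_near.
have Ll : L0%:R <= ln (N%:R : R) by near: N; exact: ln_nat_near.
have l0 : 1 <= ln (N%:R : R) by near: N; exact: ln_nat_near.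
(* One bound of the form C (log N)^3 <= N gives all the smallness conditions on
   L * log N below. *)
have l_poly : (lagC + 1) ^+ 2 * (lam + 2 + 4 / eta + lam / eta) * ln (N%:R : R) ^+ 3 <= N%:R.
  by near: N; exact: poly_le_nat.
set l : R := ln N%:R in tl' el Ll l0 l_poly *; pose g := lag N; pose L := (g * g)%N.
pose M := (Num.truncn ((t%:R + 1) * N%:R / (lam * l))).+1.
have Nr : 0 < N%:R :> R by rewrite ltr0n.
have ie0 : 0 < eta^-1 by rewrite invr_gt0.
have ll : 0 < lam * l by rewrite mulr_gt0; lra.
have /andP[g1 g2] : (lagC * l <= g%:R) && (g%:R <= lagC * l + 1) by apply: lag_bounds; apply: le_trans ler01 l0.
have lg : l <= g%:R by apply: le_trans g1; rewrite ler_peMl //; lra.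
have g0 : (0 < g)%N by [].
have L0L : (L0 <= L)%N.
  apply: (@leq_trans g); last by rewrite leq_pmulr.
  by rewrite -(ler_nat R) (le_trans Ll).
pose X := (lagC + 1) ^+ 2 * l ^+ 2.
have gl2 : g%:R <= (lagC + 1) * l by rewrite mulrDl mul1r; lra.
have LX : L%:R <= X by rewrite /L /X natrM -exprMn expr2 ler_pM.
have L1 : 1 <= L%:R :> R by rewrite ler1n muln_gt0 g0.
have X1 : 1 <= X by lra.
have lX : X * l * (lam + 2 + 4 / eta + lam / eta) <= N%:R.
  by move: l_poly; congr (_ <= _); rewrite /X; ring.
have le0 : 0 < lam / eta by rewrite mulr_gt0 // (lt_trans _ lam0).
have Xl : X <= X * l by rewrite ler_peMr //; lra.
have Xl0 : 0 <= X * l by lra.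
have lXs (c : R) : c <= lam + 2 + 4 / eta + lam / eta -> X * l * c <= N%:R.
  by move=> h; apply: le_trans lX; rewrite ler_wpM2l.
have ln : lam * l <= N%:R.
  apply: le_trans (lXs lam _); last by lra.
  rewrite [X * l]mulrC mulrAC [lam * l]mulrC ler_peMr //; lra.
have Lln : L%:R * lam * l <= eta * N%:R.
  have h : X * l * (lam / eta) <= N%:R by apply: lXs; lra.
  have := ler_wpM2l (ltW eta0) h.
  apply: le_trans; have -> : eta * (X * l * (lam / eta)) = X * (lam * l) by field; lra.
  by rewrite -mulrA ler_wpM2r // ltW.
have Ln : 2 * L%:R <= eta * N%:R.
  have h : X * l * (4 / eta) <= N%:R by apply: lXs; lra.
  have := ler_wpM2l (ltW eta0) h.
  apply: le_trans; have -> : eta * (X * l * (4 / eta)) = 4 * (X * l) by field; lra.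
  lra.
have LN : 2 * L%:R <= N%:R :> R.
  have h : X * l * 2 <= N%:R by apply: lXs; lra.
  by lra.
have gleL : (g <= L)%N by rewrite /L leq_pmulr.
have LgN : (L + g <= N)%N.
  by rewrite -(ler_nat R) natrD; move: gleL; rewrite -(ler_nat R); lra.
pose K := (N %/ (L + g))%N.
have K0 : (0 < K)%N by rewrite divn_gt0 //; lia.
pose k := K.-1.
have kE : k.+1 = K by rewrite prednK.
have kN : (k.+1 * (L + g) <= N)%N by rewrite kE leq_divM.
have kn : N%:R <= (k%:R + 2) * (L%:R + g%:R) :> R.
  rewrite -!natrD -natrM ler_nat addn2 kE ltnW // ltn_ceil //; lia.
have /andP[m1 m2] : (Num.truncn ((t%:R + 1) * N%:R / (lam * l)))%:R
   <= (t%:R + 1) * N%:R / (lam * l) < M%:R by apply: truncn_itv; apply: divr_ge0; [rewrite mulr_ge0 // addr_ge0 | exact: ltW].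
have M0 : 0 < M%:R :> R by rewrite ltr0n.
have M1 : (t%:R + 1) * N%:R <= M%:R * (lam * l).
  by rewrite -ler_pdivrMr // ltW.
have M2 : M%:R * (lam * l) <= (t%:R + 1) * N%:R + lam * l.
  have : M%:R <= (t%:R + 1) * N%:R / (lam * l) + 1.
    by rewrite /M -natr1 lerD2r.
  by move/(ler_wpM2r (ltW ll)); rewrite mulrDl mul1r divfK // gt_eqF.
have l0' : 0 <= l by apply: le_trans l0.
have lll : l <= lam * l by rewrite ler_peMl // ltW.
have tl : t%:R + 2 <= lam * l by apply: le_trans lll.
have MN : (M <= N)%N.
  rewrite -(ler_nat R) -(ler_pM2r ll) (le_trans M2) //.
  have h : (t%:R + 2) * (N%:R - 1) <= lam * l * (N%:R - 1).
    by rewrite ler_wpM2r // subr_ge0 ler1n.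
  have : t%:R + 2 <= N%:R :> R by apply: le_trans tl ln.
  by move: h; rewrite [N%:R * _]mulrC; clear; nra.
have tM : (t <= M)%N.
  rewrite -(ler_nat R) -(ler_pM2r ll) (le_trans _ M1) //.
  apply: (@le_trans _ _ (t%:R * N%:R)); first by rewrite ler_wpM2l.
  by rewrite ler_wpM2r // lerDl.
have eg : 1 <= eta * g%:R.
  have : eta^-1 <= g%:R by apply: le_trans lg.
  by move/(ler_wpM2l (ltW eta0)); rewrite mulfV // gt_eqF.
have eN : 1 <= eta * N%:R.
  apply: le_trans eg _; rewrite ler_wpM2l ?(ltW eta0) // ler_nat.
  exact: leq_trans gleL (leq_trans (leq_addr g L) LgN).
have w0 : (0 < N ^ 4)%N by rewrite expn_gt0 N0.
have cov := large_gap_covered q1 a0 alac (ltn0Sn _ : (0 < M)%N) w0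
  (mesh_lag N0 MN eN) tM (leq_trans g0 gleL) g0 eta4 gam0 (fun p p1 => HL L p L0L p1) kN.
apply: covered_sub cov => [x [x01 gap]|].
  split => //; apply: le_lt_trans gap.
  by rewrite ler_pdivrMr // mulrAC ler_pdivlMr // [leRHS]mulrC.
set rate := _ * (1 - 4 * eta).
have rk : (1 + eta) * l <= rate * k%:R.
  rewrite /rate; apply: (@block_rate_ge _ gam lam eta N%:R l g%:R) => //; try exact: ltW.
  by rewrite /L natrM.
have rate1 : rate <= 1.
  by apply: block_rate_le1 => //; exact: ltW.
have h1 : (1 - rate) ^+ k <= expR (- ((1 + eta) * l)).
  apply: (@le_trans _ _ (expR (- rate) ^+ k)).
    by rewrite lerXn2r ?nnegrE ?subr_ge0 ?expR_ge0 // expR_ge1Dx.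
  by rewrite -expRM_natr ler_expR mulNr lerN2.
have h2 : k%:R * (N%:R / (N ^ 4)%:R) <= N%:R * (N%:R / (N ^ 4)%:R) :> R.
  rewrite ler_wpM2r ?divr_ge0 // ler_nat.
  by apply: (@leq_trans K); rewrite ?leq_pred ?leq_div.
apply: (@le_trans _ _ (N%:R * (expR (- ((1 + eta) * l)) + N%:R * (N%:R / (N ^ 4)%:R)))).
  have r0 : 0 <= (1 - rate) ^+ k by rewrite exprn_ge0 // subr_ge0.
  rewrite ler_pM ?ler_nat ?lerD // addr_ge0 // mulr_ge0 // divr_ge0 //.
have NE : N%:R = expR l :> R by exact: natr_lnK.
rewrite mulrDr [2 * expR _]mulr_natl mulr2n lerD //.
  by rewrite NE -expRD ler_expR mulrDl mul1r opprD addrA addrN add0r.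
have -> : N%:R * (N%:R * (N%:R / (N ^ 4)%:R)) = N%:R^-1 :> R.
  by rewrite natrX; field; rewrite gt_eqF.
by rewrite NE -expRN ler_expR lerN2 ler_piMl.
Unshelve. all: by end_near. Qed.

(** The potential starts at th = 1 / (8 g^2) and M cells; shrinking th by 1 - 2 / M
    per step leaves th * M of order N^(1 - 2c) up to powers of log N, which
    exceeds 3 log N.  The intermediate constant c' absorbs the
    rounding of M. *)
Lemma small_gap_rare (c : R) : 0 < c -> c < 1 / 2 ->
  \forall N \near \oo, covered
    [set x | 0 <= x < 1 /\ max_gap a N x < c * ln N%:R / N%:R]
    (2 * expR 1 * expR (- (2 * ln N%:R))).
Proof.
move=> c0 c1; pose c' := (c + 1 / 2) / 2.
have cc' : c < c' by rewrite /c'; lra.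
have c'1 : c' < 1 / 2 by rewrite /c'; lra.
have dc : 0 < c' - c by rewrite subr_gt0.
have eps0 : 0 < 1 - 2 * c' by lra.
have A1 := lagC_ge1.
near=> N.
have N0 : (0 < N)%N by near: N; exact: nbhs_infty_ge.
have Nr : 0 < N%:R :> R by rewrite ltr0n.
have l1 : c^-1 + 2 <= ln (N%:R : R) by near: N; exact: ln_nat_near.
have p1 : 3 * c' * c / (c' - c) * ln (N%:R : R) ^+ 1 <= N%:R.
  by near: N; exact: poly_le_nat.
have p2 : 2 * (lagC + 1) * ln (N%:R : R) ^+ 2 <= N%:R.
  by near: N; exact: poly_le_nat.
have p3 : 48 * (lagC + 1) ^+ 2 * ln (N%:R : R) ^+ 4 <= expR ((1 - 2 * c') * ln N%:R).
  by near: N; exact: poly_le_expR.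
have NE : N%:R = expR (ln N%:R) :> R by exact: natr_lnK.
set l : R := ln N%:R in l1 p1 p2 p3 NE *; pose g := lag N.
pose M := Num.truncn (N%:R / (c * l)).
have ic0 : 0 < c^-1 by rewrite invr_gt0.
have l2 : 2 <= l by apply: le_trans l1; rewrite lerDr ltW.
have l0 : 0 <= l by apply: le_trans l2.
have lp : 0 < l by apply: lt_le_trans l2.
have cl0 : 0 < c * l by rewrite mulr_gt0.
have cl1 : 1 <= c * l.
  have : c^-1 <= l by apply: le_trans l1; rewrite lerDl.
  by move/(ler_wpM2l (ltW c0)); rewrite mulfV // gt_eqF.
have /andP[g1 g2] : (lagC * l <= g%:R) && (g%:R <= lagC * l + 1) by exact: lag_bounds.
have lg : l <= g%:R by apply: le_trans g1; rewrite ler_peMl.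
have g0 : (0 < g)%N by [].
have gr : 0 < g%:R :> R by rewrite ltr0n.
have gl : g%:R <= (lagC + 1) * l.
  by apply: le_trans g2 _; rewrite [(lagC + 1) * l]mulrDl mul1r lerD2l; apply: le_trans l2; rewrite ler1n.
have nl : l <= N%:R.
  apply: le_trans p2; rewrite expr2 mulrA ler_peMl //.
  have : 1 * 2 <= (lagC + 1) * l by rewrite ler_pM //; lra.
  lra.
have /andP[m1 m2] : M%:R <= N%:R / (c * l) < M.+1%:R.
  by apply: truncn_itv; apply: divr_ge0 => //; apply: ltW.
have mc : M%:R * (c * l) <= N%:R by rewrite -ler_pdivlMr.
have mc' : N%:R <= (M%:R + 1) * (c * l) by rewrite -ler_pdivrMr // natr1 ltW.
have Ml : N%:R <= M%:R * l.
  have h : (M%:R + 1) * (c * l) <= (M%:R + 1) * (1 / 2 * l).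
    by rewrite ler_wpM2l // ?addr_ge0 // ler_wpM2r // ltW.
  have := le_trans mc' h; rewrite mulrDl !mul1r mulrCA => h2.
  have : N%:R <= 2^-1 * (M%:R * l + l) by rewrite mulrDr.
  lra.
have gM2 : 2 * g%:R <= M%:R :> R.
  rewrite -(ler_pM2r lp) (le_trans _ Ml) // (le_trans _ p2) //.
  by rewrite expr2 mulrA ler_wpM2r // -mulrA ler_wpM2l.
have M4 : 4 <= M%:R :> R by apply: le_trans gM2; have := le_trans l2 lg; lra.
have Mr : 0 < M%:R :> R by apply: lt_le_trans M4.
have M0 : (0 < M)%N by rewrite -(ltr0n R).
have M1 : (1 < M)%N by rewrite -(ltr_nat R); apply: lt_le_trans M4; rewrite ltr_nat.
have gM : (g <= M)%N by rewrite -(ler_nat R); lra.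
have MN : (M <= N)%N.
  by rewrite -(ler_nat R) (le_trans _ mc) // ler_peMr.
have gN : (g <= N)%N by apply: leq_trans MN.
have eN : 1 <= 1 / 2 * N%:R :> R by have := le_trans l2 nl; lra.
have w0 : (0 < N ^ 4)%N by rewrite expn_gt0 N0.
pose th : R := (8 * g%:R ^+ 2)^-1.
have th0 : 0 <= th by rewrite invr_ge0 mulr_ge0 // exprn_ge0.
have thE : th * g%:R * (8 * g%:R) = 1 by rewrite /th; field; rewrite gt_eqF.
have g2' : 2 <= g%:R :> R by apply: le_trans lg.
have thg : th * g%:R <= 1 / 4.
  have : th * g%:R * 16 <= th * g%:R * (8 * g%:R).
    by rewrite ler_wpM2l ?mulr_ge0 //; clear - g2'; lra.
  by rewrite thE; clear; lra.
have cov := small_gap_covered q1 a0 alac M0 w0 (mesh_lag N0 MN eN) M1 g0 gN gM (lexx _) th0 thg.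
apply: covered_sub cov => [x [x01 gap]|].
  split => //; apply: lt_le_trans gap _.
  by rewrite ler_pdivrMr // ler_pdivlMl // .
have h1 : expR (2 * th / M%:R * g.-1%:R * N%:R) <= expR 1.
  rewrite ler_expR.
  apply: (@le_trans _ _ (2 * th * g%:R * (N%:R / M%:R))).
    rewrite (_ : _ * N%:R = 2 * th * g.-1%:R * (N%:R / M%:R)); last by ring.
    rewrite ler_wpM2r ?divr_ge0 // ler_wpM2l ?mulr_ge0 // ler_nat leq_pred //.
  have NM : N%:R / M%:R <= g%:R :> R by rewrite ler_pdivrMr // mulrC (le_trans Ml) // ler_wpM2l.
  apply: (@le_trans _ _ (2 * th * g%:R * g%:R)).
    by rewrite ler_wpM2l // !mulr_ge0.
  by move: thE; clear; lra.
have M2 : 0 < M%:R - 2 :> R by clear - M4; lra.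
have h2 : N%:R * (2 / (M%:R - 2)) <= 2 * c' * l.
  rewrite mulrA ler_pdivrMr //.
  have p1' : 3 * c' * c * l <= N%:R * (c' - c).
    by rewrite -ler_pdivrMr // mulrAC -[l]expr1.
  have h : N%:R * c' <= (M%:R + 1) * (c * l) * c' by rewrite ler_wpM2r // ltW // (lt_trans c0).
  by rewrite -(ler_pM2l c0); clear - h p1'; lra.
have h3 : expR (- (2 * c' * l)) <= (1 - 2 / M%:R) ^+ N.
  apply: (@le_trans _ _ (expR (- (2 / (M%:R - 2))) ^+ N)).
    by rewrite -expRM_natl ler_expR mulrN lerN2.
  rewrite lerXn2r ?nnegrE ?expR_ge0 //.
    by rewrite subr_ge0 ler_pdivrMr // mul1r ler_nat.
  rewrite expRN.
  have -> : 1 - 2 / M%:R = (1 + 2 / (M%:R - 2))^-1 :> R.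
    by clear - M2 Mr; field; rewrite gt_eqF //=; lra.
  rewrite lef_pV2 ?posrE ?expR_gt0 ?expR_ge1Dx // addr_gt0 // divr_gt0 //.
have h4 : 3 * l <= th * (1 - 2 / M%:R) ^+ N * (M%:R - g%:R).
  apply: (@le_trans _ _ (th * expR (- (2 * c' * l)) * (M%:R / 2))); last first.
    rewrite ler_pM ?mulr_ge0 ?expR_ge0 ?invr_ge0 //; first by rewrite ler_wpM2l.
    by clear - gM2; lra.
  have h5 : 48 * g%:R ^+ 2 * l ^+ 2 <= N%:R * expR (- (2 * c' * l)).
    apply: (@le_trans _ _ (expR ((1 - 2 * c') * l))); last first.
      by rewrite NE -expRD ler_expR mulrBl mul1r.
    apply: le_trans p3.
    rewrite (_ : 48 * (lagC + 1) ^+ 2 * l ^+ 4 = 48 * ((lagC + 1) * l) ^+ 2 * l ^+ 2); last by ring.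
    rewrite ler_wpM2r ?exprn_ge0 // ler_wpM2l // lerXn2r ?nnegrE //.
    by rewrite mulr_ge0 // addr_ge0 // (le_trans _ A1).
  have h6 : 48 * g%:R ^+ 2 * l ^+ 2 <= M%:R * l * expR (- (2 * c' * l)).
    by apply: le_trans h5 _; rewrite ler_wpM2r ?expR_ge0.
  rewrite /th -(ler_pM2l (_ : 0 < 16 * g%:R ^+ 2 * l)); last first.
    by rewrite !mulr_gt0 // exprn_gt0.
  have -> : 16 * g%:R ^+ 2 * l * (3 * l) = 48 * g%:R ^+ 2 * l ^+ 2 by ring.
  apply: le_trans h6 _; rewrite le_eqVlt; apply/orP; left; apply/eqP; field.
  by rewrite gt_eqF.
have NN : N%:R * (N%:R / (N ^ 4)%:R) = expR (- (2 * l)) :> R.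
  rewrite expRN expRM_natl -NE natrX; field; rewrite gt_eqF //.
rewrite NN [2 * expR 1]mulrC -[leRHS]mulrA; apply: ler_pM => //; try exact: expR_ge0.
rewrite [2 * expR _]mulr_natl mulr2n lerD // ler_expR lerN2; apply: le_trans h4.
by rewrite ler_wpM2r // (_ : 1 + 1 = 2) // ler_nat.
Unshelve. all: by end_near. Qed.

End Events.

(** * Almost sure bounds *)

Section AlmostEverywhereLogic.
Variable R : realType.
Notation mu := (@lebesgue_measure R).

Lemma ae_imply (P Q : R -> Prop) : (forall x, P x -> Q x) ->
  {ae mu, forall x, P x} -> {ae mu, forall x, Q x}.
Proof. by move=> PQ; apply: negligibleS => x nQ /PQ. Qed.

Lemma ae_conj (P Q : R -> Prop) :
  {ae mu, forall x, P x} -> {ae mu, forall x, Q x} -> {ae mu, forall x, P x /\ Q x}.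
Proof.
move=> aP aQ; apply: (negligibleS _ (negligibleU aP aQ)) => x /= /not_andP.
by case; [left|right].
Qed.

End AlmostEverywhereLogic.

Section AlmostEverywhere.
Variables (R : realType) (a : nat -> nat) (q : R).
Hypothesis q1 : 1 < q.
Hypothesis a0 : forall n, (1 <= n)%N -> (0 < a n)%N.
Hypothesis alac : forall n, (1 <= n)%N -> q * (a n)%:R <= (a n.+1)%:R.
Notation mu := (@lebesgue_measure R).

Lemma near_nat_bound (P : nat -> Prop) : (\forall N \near \oo, P N) ->
  exists N0, forall N, (N0 <= N)%N -> P N.
Proof. by move=> [N0 _ H]; exists N0 => N; exact: H. Qed.

(** The exceptional sets have measure O(N^(-2)); the comparison series
    1 / (N (N + 1)) telescopes. *)
Lemma gap_lower_ae (c : R) : 0 < c -> c < 1 / 2 ->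
  {ae mu, forall x, circle x -> exists N0, forall N, (N0 <= N)%N ->
     c <= normalized_gap a x N}.
Proof.
move=> c0 c1; have /near_nat_bound[N1 HN1] := small_gap_rare q1 a0 alac c0 c1.
pose p N : R := 4 * expR 1 * (N%:R * N.+1%:R)^-1.
have p0 N : 0 <= p N by rewrite !mulr_ge0 ?expR_ge0 // invr_ge0 mulr_ge0.
have psum n : \sum_(0 <= k < n) p k <= 4 * expR 1.
  rewrite -mulr_sumr ler_piMr ?mulr_ge0 ?expR_ge0 //.
  have tel m : \sum_(0 <= k < m.+1) (k%:R * k.+1%:R)^-1 = 1 - m.+1%:R^-1 :> R.
    elim: m => [|m IH]; first by rewrite big_nat1 mul0r invr0 invr1 subrr.
    rewrite big_nat_recr //= IH -[m.+2%:R]natr1; field.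
    by rewrite -!(natrD _ 1) natr1 !pnatr_eq0.
  case: n => [|n]; first by rewrite big_geq.
  by rewrite tel lerBlDr lerDl invr_ge0.
have cov N : (maxn 1 N1 <= N)%N ->
    covered [set x | 0 <= x < 1 /\ max_gap a N x < c * ln N%:R / N%:R] (p N).
  rewrite geq_max => /andP[N0 NN]; apply: covered_sub (HN1 N NN) => //.
  rewrite /p -!mulrA; apply: (@le_trans _ _ (2 * (expR 1 * (N%:R ^+ 2)^-1))).
    by rewrite expRN expRM_natl -natr_lnK.
  rewrite (_ : 4 * _ = 2 * (expR 1 * (2 * (N%:R * N.+1%:R)^-1))); last by ring.
  rewrite ler_wpM2l // ler_wpM2l ?expR_ge0 //.
  have Nr : 0 < N%:R :> R by rewrite ltr0n.
  rewrite expr2 !invfM mulrCA ler_wpM2l ?invr_ge0 //.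
  rewrite ler_pdivlMr ?ltr0n // mulrC ler_pdivrMr // -natr1 mulr_natl mulr2n lerD2l.
  by rewrite ler1n.
apply: ae_imply (ae_eventually cov p0 psum) => x [K HK].
rewrite /circle /= in_itv /= => x01.
exists (maxn K 2) => N; rewrite geq_max => /andP[KN N2].
have Npos : (0 < N)%N by apply: leq_trans N2.
have Nr : 0 < N%:R :> R by rewrite ltr0n.
have lr : 0 < ln N%:R :> R by rewrite ln_gt0 // ltr1n.
rewrite /normalized_gap ler_pdivlMr // -ler_pdivrMl // mulrC leNgt.
by apply/negP => gap; apply: (HK N KN); split.
Qed.

(** The exceptional sets are only O(N^(-eta)), so Borel-Cantelli is applied along
    N = ceil (rho ^ k).  Since the maximal gap decreases in N, the bound extends
    to all N at the cost of a factor rho. *)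
Lemma gap_upper_ae (e : R) : 0 < e ->
  {ae mu, forall x, circle x -> exists N0, forall N, (N0 <= N)%N ->
     normalized_gap a x N <= 1 + 2 * fine (Gamma a : \bar R) + e}.
Proof.
move=> e0; set G := fine _.
have G0 : 0 <= G by rewrite /G fine_ge0 //; have [] := Gamma_bounds q1 a0 alac.
pose gam := G + e / 8; pose lam := 1 + 2 * G + e / 2.
pose rho := (1 + 2 * G + e) / lam.
have lam1 : 1 < lam by rewrite /lam; lra.
have lam0 : 0 < lam by lra.
have rho1 : 1 < rho by rewrite /rho ltr_pdivlMr // mul1r /lam; lra.
have rhoE : rho * lam = 1 + 2 * G + e by rewrite /rho divfK // gt_eqF.
have lr : 0 < ln rho by rewrite ln_gt0.
have Ggam : G < gam by rewrite /gam; lra.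
have [L0 HL] := correlations_le q1 a0 alac (gam := gam) Ggam.
have gam0 : 0 <= gam by rewrite /gam; lra.
have gl : 1 + 2 * gam < lam by rewrite /gam /lam; lra.
have [eta eta0 /near_nat_bound[N1 HN1]] := large_gap_rare q1 a0 alac gam0 gl HL.
pose Nk k := `|Num.ceil (rho ^+ k)|%N.
have NkE k : (Nk k)%:R = (Num.ceil (rho ^+ k))%:~R :> R.
  rewrite /Nk -[LHS]/((`|Num.ceil (rho ^+ k)|%N%:Z)%:~R) gez0_abs //.
  by rewrite ceil_ge0 // (lt_le_trans _ (exprn_ge0 k _)) ?ltrN10 //; lra.
have rhok k : rho ^+ k = expR (k%:R * ln rho).
  by rewrite expRM_natl lnK // posrE; lra.
have Nkge k : rho ^+ k <= (Nk k)%:R.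
  by rewrite NkE; have /andP[] := ceil_itv (rho ^+ k).
have Nk0 k : (0 < Nk k)%N.
  by rewrite -(ltr0n R); apply: lt_le_trans (Nkge k); rewrite exprn_gt0 //; lra.
have lnNk k : k%:R * ln rho <= ln (Nk k)%:R.
  by rewrite -ler_expR -natr_lnK // -rhok.
pose z := expR (- (eta * ln rho)).
have z1 : `|z| < 1.
  by rewrite gtr0_norm ?expR_gt0 // -expR0 ltr_expR oppr_lt0 mulr_gt0.
pose p k : R := 2 * z ^+ k.
have p0 k : 0 <= p k by rewrite mulr_ge0 // exprn_ge0 // expR_ge0.
have psum n : \sum_(0 <= k < n) p k <= 2 * (1 - z)^-1.
  by apply: (geometric_le_lim n _ _ z1); rewrite ?expR_gt0.
pose K0 := (Num.truncn (N1%:R / ln rho)).+1.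
have cov k : (K0 <= k)%N ->
    covered [set x | 0 <= x < 1 /\ lam * ln (Nk k)%:R / (Nk k)%:R < max_gap a (Nk k) x] (p k).
  move=> Kk; have NN : (N1 <= Nk k)%N.
    rewrite -(ler_nat R); apply: le_trans (Nkge k); rewrite rhok.
    apply: le_trans (expR_ge1Dx _).
    have /andP[_ h] := truncn_itv (divr_ge0 (ler0n R N1) (ltW lr)).
    have : N1%:R / ln rho <= k%:R by apply: le_trans (ltW h) _; rewrite ler_nat.
    by rewrite ler_pdivrMr // => h2; apply: le_trans h2 _; rewrite lerDr.
  apply: covered_sub (HN1 _ NN) => //.
  rewrite /p ler_wpM2l // /z -expRM_natr ler_expR mulNr lerN2 -mulrA ler_wpM2l ?(ltW eta0) //.
  by rewrite mulrC.
apply: ae_imply (ae_eventually cov p0 psum) => x [K HK].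
rewrite /circle /= in_itv /= => x01.
have [N0 HN0] := near_nat_bound (ln_nat_near (K%:R * ln rho + 1)).
exists (maxn N0 2) => N; rewrite geq_max => /andP[N0N N2].
have Npos : (0 < N)%N by apply: leq_trans N2.
have Nr : 0 < N%:R :> R by rewrite ltr0n.
have lN : 0 < ln N%:R :> R by rewrite ln_gt0 // ltr1n.
pose k := Num.truncn (ln N%:R / ln rho).
have /andP[k1 k2] : k%:R <= ln N%:R / ln rho < k.+1%:R.
  by apply: truncn_itv; rewrite divr_ge0 // ltW.
have Kk : (K <= k)%N.
  rewrite -ltnS -(ltr_nat R); apply: le_lt_trans k2.
  rewrite ler_pdivlMr //; apply: le_trans (HN0 N N0N).
  by rewrite lerDl.
have NE : N%:R = expR (ln N%:R) :> R by exact: natr_lnK.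
have NkN : (Nk k <= N)%N.
  rewrite -(ler_nat R) NkE -[N%:R]/((N%:Z)%:~R) ler_int ceil_le_int rhok.
  by rewrite [leRHS]NE ler_expR -ler_pdivlMr.
have NNk : N%:R <= rho * (Nk k)%:R.
  apply: (@le_trans _ _ (rho ^+ k.+1)).
    by rewrite rhok [leLHS]NE ler_expR -ler_pdivrMr // ltW.
  by rewrite exprS ler_wpM2l //; lra.
have gap : max_gap a (Nk k) x <= lam * ln (Nk k)%:R / (Nk k)%:R.
  by rewrite leNgt; apply/negP => gap; apply: (HK k Kk); split.
have Nkr : 0 < (Nk k)%:R :> R by rewrite ltr0n.
rewrite /normalized_gap ler_pdivrMr // -rhoE.
apply: (@le_trans _ _ (N%:R * (lam * ln (Nk k)%:R / (Nk k)%:R))).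
  by rewrite ler_wpM2l // (le_trans _ gap) // max_gap_mono.
rewrite mulrA ler_pdivrMr //.
have lnk : ln (Nk k)%:R <= ln N%:R :> R by rewrite ler_ln ?posrE // ler_nat.
have lnk0 : 0 <= ln (Nk k)%:R :> R by rewrite ln_ge0 // ler1n.
have -> : rho * lam * ln N%:R * (Nk k)%:R = (rho * (Nk k)%:R) * (lam * ln N%:R) by ring.
by rewrite ler_pM ?mulr_ge0 ?ler_wpM2l // ltW.
Qed.

End AlmostEverywhere.

Theorem theorem1p1 (R : realType) (q : R) (a : nat -> nat)
    (hq : 1 < q)
    (ha_pos : forall n : nat, (1 <= n)%N -> (0 < a n)%N)
    (ha_lac : forall n : nat, (1 <= n)%N -> q * (a n)%:R <= (a n.+1)%:R) :
  {ae lebesgue_measure, forall x : R, circle x ->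
    ((1 / 2)%:E <= limn_einf (fun N => (normalized_gap a x N)%:E))%E /\
    (limn_esup (fun N => (normalized_gap a x N)%:E) <= 1 + 2%:E * Gamma a)%E}
  /\ (1 + 2%:E * Gamma a <= ((q + 1) / (q - 1))%:E)%E.
Proof.
set G := fine (Gamma a : \bar R).
have GE : (1 + 2%:E * Gamma a = (1 + 2 * G)%:E)%E.
  by rewrite (Gamma_fine hq ha_pos ha_lac) -EFinM -EFinD.
have inv_small (e : R) : 0 < e -> exists i : nat, i.+2%:R^-1 <= e.
  move=> e0; exists (Num.truncn e^-1).
  have /andP[_ h] : (Num.truncn e^-1)%:R <= e^-1 < (Num.truncn e^-1).+1%:R.
    by apply: truncn_itv; rewrite invr_ge0 ltW.
  by rewrite invf_ple ?posrE // (le_trans (ltW h)) // ler_nat.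
split; last first.
  rewrite GE lee_fin; have [_] := Gamma_bounds hq ha_pos ha_lac.
  rewrite (Gamma_fine hq ha_pos ha_lac) -/G lee_fin => h.
  have q0 : 0 < q - 1 by lra.
  have -> : (q + 1) / (q - 1) = 1 + 2 * (q - 1)^-1 by field; lra.
  by rewrite lerD2l ler_wpM2l.
have i0 (i : nat) : 0 < i.+2%:R^-1 :> R by rewrite invr_gt0.
have lo : {ae lebesgue_measure, forall x : R, forall i : nat, circle x ->
    exists N0, forall N, (N0 <= N)%N -> 1 / 2 - i.+2%:R^-1 / 2 <= normalized_gap a x N}.
  apply/ae_foralln => i; have i1 : i.+2%:R^-1 < 1 :> R by rewrite invf_lt1 // ltr1n.
  move: (i0 i) i1; set r := _^-1 => r0 r1.
  by apply: (gap_lower_ae hq ha_pos ha_lac); lra.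
have hi : {ae lebesgue_measure, forall x : R, forall i : nat, circle x ->
    exists N0, forall N, (N0 <= N)%N -> normalized_gap a x N <= 1 + 2 * G + i.+2%:R^-1}.
  by apply/ae_foralln => i; apply: (gap_upper_ae hq ha_pos ha_lac).
apply: ae_imply (ae_conj lo hi) => x [{}lo {}hi] xc; split.
  apply/lee_addgt0Pr => e e0; have [i ie] := inv_small e e0.
  have [N0 HN0] := lo i xc.
  rewrite -leeBlDr // -EFinB; apply: (limn_einf_ge (N0 := N0)) => N NN.
  rewrite lee_fin (le_trans _ (HN0 N NN)) //.
  have half (r : R) : 0 < r -> r <= e -> 1 / 2 - e <= 1 / 2 - r / 2 by lra.
  exact: half (i0 i) ie.
rewrite GE; apply/lee_addgt0Pr => e e0; have [i ie] := inv_small e e0.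
have [N0 HN0] := hi i xc.
rewrite -EFinD; apply: (limn_esup_le (N0 := N0)) => N NN.
by rewrite lee_fin (le_trans (HN0 N NN)) // lerD2l.
Qed.
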